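(* In the setting described in the context: (1) If the model is data uniformly relevant (DUR), the parametrisation $\mathcal P_1=(\tilde X,\Theta)$ is geometrically tight in parameter (GTIP), and $\mathcal L(Z_2)$ has a finite moment generating function in a neighbourhood of $0$, then $\mathcal P_0=(X,\Theta)$ is geometrically ergodic. (2) If the model is parameter uniformly relevant (PUR), $\mathcal P_0$ is GTIP, and $\mathcal L(Z_1)$ has a finite moment generating function in a neighbourhood of $0$, then $\mathcal P_1$ is geometrically ergodic.
   Context: Fix an observed value $y\in\mathbb R$. Consider the model $Y=X+Z_1$, $X=\Theta+Z_2$, where $Z_1,Z_2$ are independent real random variables, independent of $\Theta$, whose distributions are symmetric about $0$ and have continuous, bounded, everywhere positive Lebesgue densities $f_1,f_2$; $\Theta$ is given the improper flat (Lebesgue) prior on $\mathbb R$, and the posterior $\mathcal L(X,\Theta\mid Y=y)$ is proper. Write $\tilde X=X-\Theta$. For a parametrisation $\mathcal P=(U,\Theta)$ with $U\in\{X,\tilde X\}$, the Gibbs sampler started at $\Theta_0$ iterates, for $n\ge1$: draw $U_n\sim\mathcal L(U\mid Y=y,\Theta=\Theta_{n-1})$, then $\Theta_n\sim\mathcal L(\Theta\mid Y=y,U=U_n)$. The centred parametrisation is $\mathcal P_0=(X,\Theta)$ and the non-centred one is $\mathcal P_1=(\tilde X,\Theta)$. A parametrisation is called geometrically ergodic if its marginal chain $\{\Theta_n\}$ satisfies $\|\mathcal L(\Theta_n\mid Y=y,\Theta_0)-\mathcal L(\Theta\mid Y=y)\|_{TV}\le M(\Theta_0)r^n$ for all $n$,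 for some $r<1$ and some function $M$. A parametrisation $(U,\Theta)$ is GTIP (geometrically tight in parameter) if there are constants $a,b>0$ not depending on $\theta$ such that $\mathbf P(|U|>x\mid Y=y,\Theta=\theta)\le ae^{-bx}$ for all $\theta\in\mathbb R$ and $x\ge0$. The model is DUR (data uniformly relevant) if there are $d,k>0$ such that $|\mathbf E\{X\mid Y=y,\Theta=\theta\}|\le|\theta|-d$ for all $|\theta|>k$; it is PUR (parameter uniformly relevant) if there are $d,k>0$ such that $\operatorname{sgn}(\theta)\,\mathbf E\{X-y\mid Y=y,\Theta=\theta\}\ge d$ for all $|\theta|>k$. *)

(* Defs.v *)
From Stdlib Require Import Reals Lra ClassicalEpsilon.
Open Scope R_scope.

Definition RInt_eq (f : R -> R) (a b I : R) : Prop :=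
  exists pr : Riemann_integrable f a b, RiemannInt pr = I.

Definition improper_int (f : R -> R) (I : R) : Prop :=
  (forall a b, exists J, RInt_eq f a b J) /\
  (forall eps, 0 < eps -> exists M, forall a b J,
      a <= - M -> M <= b -> RInt_eq f a b J -> Rabs (J - I) < eps).

Definition integrable (f : R -> R) : Prop := exists I, improper_int f I.

(** The value of the integral over R (chosen classically; unique when it exists). *)
Definition Integral (f : R -> R) : R :=
  epsilon (inhabits 0) (fun I => improper_int f I).

Definition good_density (f : R -> R) : Prop :=
  continuity f /\ (exists B, forall z, f z <= B) /\ (forall z, 0 < f z) /\
  (forall z, f (- z) = f z) /\ improper_int f 1.

(** Unnormalised joint posterior density of (U, Theta) given Y = y
    (flat prior on Theta) in each parametrisation. *)
(* P0 = (X, Theta) :  Y = X + Z1, X = Theta + Z2 *)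
Definition P0 (f1 f2 : R -> R) (y : R) (u th : R) : R := f1 (y - u) * f2 (u - th).
(* P1 = (Xtilde, Theta) with Xtilde = X - Theta (Jacobian 1) *)
Definition P1 (f1 f2 : R -> R) (y : R) (u th : R) : R := f1 (y - (u + th)) * f2 u.

Definition condU (g : R -> R -> R) (th u : R) : R :=
  g u th / Integral (fun v => g v th).
Definition condT (g : R -> R -> R) (u th : R) : R :=
  g u th / Integral (fun t => g u t).

(** Transition density of the marginal Gibbs chain {Theta_n}. *)
Definition kern (g : R -> R -> R) (th th' : R) : R :=
  Integral (fun u => condU g th u * condT g u th').

(** step_dens g th0 m = density of L(Theta_{m+1} | Y=y, Theta_0 = th0). *)
Fixpoint step_dens (g : R -> R -> R) (th0 : R) (m : nat) : R -> R :=
  match m with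
  | O => kern g th0
  | S k => fun th' => Integral (fun t => step_dens g th0 k t * kern g t th')
  end.

Definition post (g : R -> R -> R) (th : R) : R :=
  Integral (fun u => g u th) / Integral (fun t => Integral (fun u => g u t)).

(** Total variation distance between L(Theta_n | Y=y, Theta_0=th0) and
    L(Theta | Y=y); for n = 0 the law is a point mass and the posterior has a
    density, so the distance is 1.  For n >= 1 both laws have densities and
    TV = (1/2) * L1 distance of the densities. *)
Definition tv_dist (g : R -> R -> R) (th0 : R) (n : nat) : R :=
  match n with
  | O => 1
  | S m => / 2 * Integral (fun t => Rabs (step_dens g th0 m t - post g t))
  end.

Definition geom_ergodic (g : R -> R -> R) : Prop :=
  exists (r : R) (M : R -> R), r < 1 /\
    forall (th0 : R) (n : nat), tv_dist g th0 n <= M th0 * r ^ n.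

Definition tail_prob (g : R -> R -> R) (th x : R) : R :=
  Integral (fun u => if Rle_dec (Rabs u) x then 0 else condU g th u).

Definition GTIP (g : R -> R -> R) : Prop :=
  exists a b, 0 < a /\ 0 < b /\
    forall th x, 0 <= x -> tail_prob g th x <= a * exp (- (b * x)).

Definition condExpX (f1 f2 : R -> R) (y th : R) : R :=
  Integral (fun x => x * condU (P0 f1 f2 y) th x).

Definition sgn (t : R) : R :=
  if Rlt_dec 0 t then 1 else if Rlt_dec t 0 then -1 else 0.

Definition DUR (f1 f2 : R -> R) (y : R) : Prop :=
  exists d k, 0 < d /\ 0 < k /\
    forall th, Rabs th > k -> Rabs (condExpX f1 f2 y th) <= Rabs th - d.

Definition condExpXy (f1 f2 : R -> R) (y th : R) : R :=
  Integral (fun x => (x - y) * condU (P0 f1 f2 y) th x).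

Definition PUR (f1 f2 : R -> R) (y : R) : Prop :=
  exists d k, 0 < d /\ 0 < k /\
    forall th, Rabs th > k -> sgn th * condExpXy f1 f2 y th >= d.

Definition mgf_finite_near0 (f : R -> R) : Prop :=
  exists delta, 0 < delta /\
    forall t, Rabs t < delta -> integrable (fun z => exp (t * z) * f z).

(* Main.v *)
(** Both parts are one statement about the chain with [u ~ f1 (y - u) f2 (u - t)]
    (normalised) followed by [t' ~ f2 (u - t')]: the substitution [u -> y - u]
    turns [P1 f1 f2 y] into [P0 f2 f1 y], and DUR, resp. PUR, says in both cases
    that the increment [u - t] has mean at most [- d] in the direction of [t]
    when [|t|] is large, while GTIP gives it exponential moments uniformly in [t].
    Hence [V t = cosh (lam t)] satisfies a geometric drift condition for small [lam].
    Compact sets are small because the densities are positive and continuous, and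
    Harris' theorem follows from a contraction of signed densities of zero mass in
    the norm [int (1 + beta V) |h|].  All functions involved are continuous, so a
    Tonelli theorem for improper Riemann integrals of continuous functions (via
    Dini's theorem) suffices. *)

Require Import Defs.
From Stdlib Require Import Reals Lra ClassicalEpsilon.
From Stdlib Require Import FunctionalExtensionality PropExtensionality Classical.
From Coquelicot Require Import Coquelicot.
Open Scope R_scope.

(** * Continuity *)

(** [Integral] is a choice operator, so an equation about it carries no information until
    convergence is known. The lemmas therefore pass around a value together with its [improper_int]
    certificate, and continuity is re-established for every kernel image, since the integral
    calculus below lives on continuous functions. DUR and PUR only fix the first-order term of the
    moment generating function of the increment; a single small [lam] works for all [t] because GTIP
    bounds the second-order remainder uniformly. The function [cosh (lam t)] is taken rather than
    [exp (lam |t|)] because it is an exact eigenfunction of convolution with an even density, so the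
    Theta update loses nothing but a constant factor. No abstract existence theorem for the
    invariant law enters: [joint] is symmetric, so the chain is reversible with respect to [marg],
    which is the posterior. In part (2) the increment of the reflected chain is [y - X]; GTIP of
    [P0] bounds [X] itself, and recentring at [y] costs the factor [exp (b / 2 * |y|)]. *)

Definition cont2 (F : R -> R -> R) : Prop := forall x t, continuity_2d_pt F x t.

Lemma cont_comp (f g : R -> R) :
  continuity f -> continuity g -> continuity (fun x => f (g x)).
Proof. intros Hf Hg; exact (continuity_comp g f Hg Hf). Qed.

Lemma cont_Rmult (f g : R -> R) :
  continuity f -> continuity g -> continuity (fun x => f x * g x).
Proof. exact (continuity_mult f g). Qed.

Lemma cont_Rplus (f g : R -> R) :
  continuity f -> continuity g -> continuity (fun x => f x + g x).
Proof. exact (continuity_plus f g). Qed.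

Lemma cont_Rminus (f g : R -> R) :
  continuity f -> continuity g -> continuity (fun x => f x - g x).
Proof. exact (continuity_minus f g). Qed.

Lemma cont_Ropp (f : R -> R) : continuity f -> continuity (fun x => - f x).
Proof. exact (continuity_opp f). Qed.

Lemma cont_Rdiv (f g : R -> R) :
  continuity f -> continuity g -> (forall x, g x <> 0) ->
  continuity (fun x => f x / g x).
Proof. exact (continuity_div f g). Qed.

Lemma cont_id : continuity (fun x => x).
Proof. exact (derivable_continuous _ derivable_id). Qed.

Lemma cont_const (c : R) : continuity (fun _ => c).
Proof. apply continuity_const; intros ? ?; reflexivity. Qed.

Lemma cont_exp : continuity exp.
Proof. exact (derivable_continuous _ derivable_exp). Qed.

Lemma cont_cosh : continuity cosh.
Proof. exact (derivable_continuous _ derivable_cosh). Qed.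

Lemma cont2_apply (F : R -> R -> R) (g h : R -> R) :
  cont2 F -> continuity g -> continuity h -> continuity (fun x => F (g x) (h x)).
Proof.
  intros HF Hg Hh x eps Heps.
  destruct (HF (g x) (h x) (mkposreal eps Heps)) as [d Hd]; simpl in Hd.
  destruct (Hg x d (cond_pos d)) as [d1 [Hd1 H1]].
  destruct (Hh x d (cond_pos d)) as [d2 [Hd2 H2]].
  exists (Rmin d1 d2); split; [apply Rmin_pos; assumption|].
  intros z [Hz1 Hz2].
  (* [continuity] quantifies over punctured neighbourhoods, so the centre is treated apart. *)
  destruct (Req_dec z x) as [->|Hn].
  { simpl; unfold R_dist; rewrite Rminus_diag, Rabs_R0; exact Heps. }
  simpl in *; unfold R_dist in *.
  pose proof (Rmin_l d1 d2); pose proof (Rmin_r d1 d2).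
  apply Hd; [apply H1|apply H2]; (split; [exact Hz1|lra]).
Qed.

Lemma cont2_fst (f : R -> R) : continuity f -> cont2 (fun x _ => f x).
Proof.
  intros Hf x t; apply (continuity_1d_2d_pt_comp f (fun u _ => u));
    [apply Hf|apply continuity_2d_pt_id1].
Qed.

Lemma cont2_snd (f : R -> R) : continuity f -> cont2 (fun _ t => f t).
Proof.
  intros Hf x t; apply (continuity_1d_2d_pt_comp f (fun _ u => u));
    [apply Hf|apply continuity_2d_pt_id2].
Qed.

Lemma cont2_comp (f : R -> R) (G : R -> R -> R) :
  continuity f -> cont2 G -> cont2 (fun x t => f (G x t)).
Proof. intros Hf HG x t; apply continuity_1d_2d_pt_comp; [apply Hf|apply HG]. Qed.

Lemma cont2_mult (F G : R -> R -> R) :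
  cont2 F -> cont2 G -> cont2 (fun x t => F x t * G x t).
Proof. intros HF HG x t; apply continuity_2d_pt_mult; [apply HF|apply HG]. Qed.

Lemma cont2_plus (F G : R -> R -> R) :
  cont2 F -> cont2 G -> cont2 (fun x t => F x t + G x t).
Proof. intros HF HG x t; apply continuity_2d_pt_plus; [apply HF|apply HG]. Qed.

Lemma cont2_minus (F G : R -> R -> R) :
  cont2 F -> cont2 G -> cont2 (fun x t => F x t - G x t).
Proof. intros HF HG x t; apply continuity_2d_pt_minus; [apply HF|apply HG]. Qed.

Lemma cont2_div (F G : R -> R -> R) :
  cont2 F -> cont2 G -> (forall x t, G x t <> 0) ->
  cont2 (fun x t => F x t / G x t).
Proof.
  intros HF HG Hn x t; apply continuity_2d_pt_mult; [apply HF|].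
  apply continuity_2d_pt_inv; [apply HG|apply Hn].
Qed.

Lemma cont2_swap (F : R -> R -> R) : cont2 F -> cont2 (fun t x => F x t).
Proof.
  intros HF t x eps; destruct (HF x t eps) as [d Hd]; exists d.
  intros u v Hu Hv; apply Hd; assumption.
Qed.

(* Constant functions must be tried before the higher-order patterns, whose
   variables would also match closed subterms. *)
Ltac cont_tac :=
  match goal with
  | H : continuity ?f |- continuity ?f => exact H
  | H : cont2 ?f |- cont2 ?f => exact H
  | |- continuity (fun _ => ?c) => apply (cont_const c)
  | |- continuity (fun x => x) => apply cont_id
  | |- continuity exp => apply cont_exp
  | |- continuity cosh => apply cont_cosh
  | |- continuity Rabs => apply Rcontinuity_abs
  | |- continuity (fun x => @?f x + @?g x) => apply (cont_Rplus f g); cont_tac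
  | |- continuity (fun x => @?f x - @?g x) => apply (cont_Rminus f g); cont_tac
  | |- continuity (fun x => @?f x * @?g x) => apply (cont_Rmult f g); cont_tac
  | |- continuity (fun x => @?f x / @?g x) => apply (cont_Rdiv f g); [cont_tac|cont_tac|]
  | |- continuity (fun x => - @?f x) => apply (cont_Ropp f); cont_tac
  | |- continuity (fun x => Rabs (@?g x)) => apply (cont_comp Rabs g); cont_tac
  | |- continuity (fun x => exp (@?g x)) => apply (cont_comp exp g); cont_tac
  | |- continuity (fun x => cosh (@?g x)) => apply (cont_comp cosh g); cont_tac
  | H : continuity ?f |- continuity (fun x => ?f (@?g x)) => apply (cont_comp f g); cont_tac
  | H : cont2 ?F |- continuity (fun x => ?F (@?g x) (@?h x)) => apply (cont2_apply F g h); cont_tac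
  | |- cont2 (fun x t => @?f x) => apply (cont2_fst f); cont_tac
  | |- cont2 (fun x t => @?f t) => apply (cont2_snd f); cont_tac
  | |- cont2 (fun x t => @?f x t + @?g x t) => apply (cont2_plus f g); cont_tac
  | |- cont2 (fun x t => @?f x t - @?g x t) => apply (cont2_minus f g); cont_tac
  | |- cont2 (fun x t => @?f x t * @?g x t) => apply (cont2_mult f g); cont_tac
  | |- cont2 (fun x t => @?f x t / @?g x t) => apply (cont2_div f g); [cont_tac|cont_tac|]
  | |- cont2 (fun x t => Rabs (@?g x t)) => apply (cont2_comp Rabs g); cont_tac
  | |- cont2 (fun x t => cosh (@?g x t)) => apply (cont2_comp cosh g); cont_tac
  | H : continuity ?f |- cont2 (fun x t => ?f (@?g x t)) => apply (cont2_comp f g); cont_tac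
  | H : cont2 ?f |- cont2 (fun x t => ?f t x) => apply (cont2_swap f H)
  | _ => idtac
  end.

(** * Improper integrals *)

Ltac rabs_split x :=
  let H := fresh in
  destruct (Rcase_abs x) as [H|H];
  [rewrite ?(Rabs_left x H) in *|rewrite ?(Rabs_right x H) in *].

Ltac rabs :=
  repeat match goal with
  | |- context [Rabs ?x] => rabs_split x
  | H : context [Rabs ?x] |- _ => rabs_split x
  end; lra.

Lemma cont_ex_RInt (f : R -> R) (a b : R) : continuity f -> ex_RInt f a b.
Proof.
  intros Hf; apply (ex_RInt_continuous (V := R_CompleteNormedModule)); intros z _.
  apply continuity_pt_filterlim, Hf.
Qed.

Lemma RInt_correct_R (f : R -> R) (a b : R) : ex_RInt f a b -> is_RInt f a b (RInt f a b).
Proof. exact (RInt_correct f a b). Qed.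

Lemma is_RInt_unique_R (f : R -> R) (a b I : R) : is_RInt f a b I -> RInt f a b = I.
Proof. exact (is_RInt_unique f a b I). Qed.

Lemma RInt_eq_is_RInt (f : R -> R) (a b I : R) :
  RInt_eq f a b I <-> is_RInt f a b I.
Proof.
  split.
  - intros [pr <-]; rewrite <- RInt_Reals.
    apply RInt_correct_R, ex_RInt_Reals_1, pr.
  - intros H; exists (ex_RInt_Reals_0 f a b (ex_intro _ I H)).
    rewrite <- RInt_Reals; apply is_RInt_unique_R, H.
Qed.

Lemma RInt_Chasles_R (f : R -> R) (a b c : R) :
  ex_RInt f a b -> ex_RInt f b c -> RInt f a b + RInt f b c = RInt f a c.
Proof. exact (RInt_Chasles f a b c). Qed.

(** Passing to Coquelicot's total [RInt] removes the integrability proof from the integral, which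
    makes rewriting possible. The two endpoints still tend to infinity independently, so this is not
    a principal value. *)
Lemma improper_intE (f : R -> R) (I : R) :
  improper_int f I <->
  (forall a b, ex_RInt f a b) /\
  (forall eps, 0 < eps -> exists M, forall a b,
      a <= - M -> M <= b -> Rabs (RInt f a b - I) < eps).
Proof.
  split.
  - intros [He Hl].
    assert (Hex : forall a b, ex_RInt f a b).
    { intros a b; destruct (He a b) as [J HJ]; exists J.
      apply RInt_eq_is_RInt, HJ. }
    split; [exact Hex|]; intros eps Heps; destruct (Hl eps Heps) as [M HM].
    exists M; intros a b Ha Hb; apply (HM a b); [assumption..|].
    apply RInt_eq_is_RInt, RInt_correct_R, Hex.
  - intros [Hex Hl]; split.
    + intros a b; exists (RInt f a b); apply RInt_eq_is_RInt, RInt_correct_R, Hex.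
    + intros eps Heps; destruct (Hl eps Heps) as [M HM]; exists M.
      intros a b J Ha Hb HJ; apply RInt_eq_is_RInt, is_RInt_unique_R in HJ.
      rewrite <- HJ; apply HM; assumption.
Qed.

Lemma improper_int_ex (f : R -> R) (I : R) :
  improper_int f I -> forall a b, ex_RInt f a b.
Proof. intros H; apply improper_intE in H; apply H. Qed.

Lemma improper_int_near (f : R -> R) (I eps : R) :
  improper_int f I -> 0 < eps ->
  exists M, 0 <= M /\ forall a b, a <= - M -> M <= b -> Rabs (RInt f a b - I) < eps.
Proof.
  intros H Heps; apply improper_intE in H; destruct (proj2 H eps Heps) as [M HM].
  exists (Rmax 0 M); split; [apply Rmax_l|].
  pose proof (Rmax_r 0 M); intros a b Ha Hb; apply HM; lra.
Qed.

Lemma improper_int_unique (f : R -> R) (I J : R) :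
  improper_int f I -> improper_int f J -> I = J.
Proof.
  intros HI HJ; apply cond_eq; intros eps Heps.
  destruct (improper_int_near _ _ (eps / 2) HI ltac:(lra)) as [M1 [_ H1]].
  destruct (improper_int_near _ _ (eps / 2) HJ ltac:(lra)) as [M2 [_ H2]].
  pose proof (Rmax_l M1 M2); pose proof (Rmax_r M1 M2).
  specialize (H1 (- Rmax M1 M2) (Rmax M1 M2) ltac:(lra) ltac:(lra)).
  specialize (H2 (- Rmax M1 M2) (Rmax M1 M2) ltac:(lra) ltac:(lra)).
  rabs.
Qed.

(** The gateway from the choice operator to an actual value: a convergence certificate pins it down
    by uniqueness. *)
Lemma Integral_eq (f : R -> R) (I : R) : improper_int f I -> Integral f = I.
Proof.
  intros H; apply (improper_int_unique f); [|exact H].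
  unfold Integral; apply epsilon_spec; exists I; exact H.
Qed.

Lemma improper_int_ext (f g : R -> R) (I : R) :
  (forall x, f x = g x) -> improper_int f I -> improper_int g I.
Proof. intros H; replace g with f; [auto|apply functional_extensionality, H]. Qed.

Lemma improper_int_plus (f g : R -> R) (I J : R) :
  improper_int f I -> improper_int g J -> improper_int (fun x => f x + g x) (I + J).
Proof.
  intros HI HJ; apply improper_intE.
  pose proof (improper_int_ex _ _ HI) as Ef; pose proof (improper_int_ex _ _ HJ) as Eg.
  split; [intros a b; apply (ex_RInt_plus f g); auto|].
  intros eps Heps.
  destruct (improper_int_near _ _ (eps / 2) HI ltac:(lra)) as [M1 [_ H1]].
  destruct (improper_int_near _ _ (eps / 2) HJ ltac:(lra)) as [M2 [_ H2]].
  exists (Rmax M1 M2); intros a b Ha Hb.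
  pose proof (Rmax_l M1 M2); pose proof (Rmax_r M1 M2).
  specialize (H1 a b ltac:(lra) ltac:(lra)); specialize (H2 a b ltac:(lra) ltac:(lra)).
  assert (E : RInt (fun x => f x + g x) a b = RInt f a b + RInt g a b)
    by exact (RInt_plus f g a b (Ef a b) (Eg a b)).
  rewrite E; rabs.
Qed.

Lemma improper_int_scal (c : R) (f : R -> R) (I : R) :
  improper_int f I -> improper_int (fun x => c * f x) (c * I).
Proof.
  intros HI; apply improper_intE; pose proof (improper_int_ex _ _ HI) as Ef.
  split; [intros a b; apply (ex_RInt_scal f a b c); auto|].
  intros eps Heps; pose proof (Rabs_pos c).
  destruct (improper_int_near _ _ (eps / (Rabs c + 1)) HI) as [M [_ HM]].
  { apply Rdiv_lt_0_compat; lra. }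
  exists M; intros a b Ha Hb; specialize (HM a b Ha Hb).
  assert (E : RInt (fun x => c * f x) a b = c * RInt f a b)
    by exact (RInt_scal f a b c (Ef a b)).
  rewrite E, <- Rmult_minus_distr_l, Rabs_mult.
  apply Rle_lt_trans with ((Rabs c) * (eps / (Rabs c + 1))).
  - apply Rmult_le_compat_l; lra.
  - apply (Rmult_lt_reg_r (Rabs c + 1)); [lra|].
    field_simplify; nra.
Qed.

Lemma improper_int_minus (f g : R -> R) (I J : R) :
  improper_int f I -> improper_int g J -> improper_int (fun x => f x - g x) (I - J).
Proof.
  intros HI HJ; replace (I - J) with (I + (-1) * J) by ring.
  apply (improper_int_ext (fun x => f x + (-1) * g x)); [intros; ring|].
  apply improper_int_plus, improper_int_scal; assumption.
Qed.

Lemma improper_int_le (f g : R -> R) (I J : R) :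
  (forall x, f x <= g x) -> improper_int f I -> improper_int g J -> I <= J.
Proof.
  intros Hle HI HJ; apply Rnot_lt_le; intros Hlt.
  destruct (improper_int_near _ _ ((I - J) / 2) HI ltac:(lra)) as [M1 [P1 H1]].
  destruct (improper_int_near _ _ ((I - J) / 2) HJ ltac:(lra)) as [M2 [P2 H2]].
  pose proof (Rmax_l M1 M2); pose proof (Rmax_r M1 M2).
  set (a := - Rmax M1 M2) in *; set (b := Rmax M1 M2) in *.
  specialize (H1 a b ltac:(unfold a; lra) ltac:(lra)).
  specialize (H2 a b ltac:(unfold a; lra) ltac:(lra)).
  assert (RInt f a b <= RInt g a b).
  { apply RInt_le; [unfold a; lra|eapply improper_int_ex; eassumption..|auto]. }
  rabs.
Qed.

Lemma RInt_mono_interval (f : R -> R) (a b c d : R) :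
  (forall x, 0 <= f x) -> (forall u v, ex_RInt f u v) ->
  c <= a -> a <= b -> b <= d -> RInt f a b <= RInt f c d.
Proof.
  intros Hp He Hca Hab Hbd.
  rewrite <- (RInt_Chasles_R f c a d), <- (RInt_Chasles_R f a b d) by auto.
  assert (0 <= RInt f c a) by (apply RInt_ge_0; auto).
  assert (0 <= RInt f b d) by (apply RInt_ge_0; auto).
  lra.
Qed.

Lemma RInt_le_improper (f : R -> R) (I a b : R) :
  (forall x, 0 <= f x) -> improper_int f I -> a <= b -> RInt f a b <= I.
Proof.
  intros Hp HI Hab; apply Rnot_lt_le; intros Hlt.
  destruct (improper_int_near _ _ ((RInt f a b - I) / 2) HI ltac:(lra)) as [M [P H]].
  pose proof (Rmin_l a (-M)); pose proof (Rmin_r a (-M)).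
  pose proof (Rmax_l b M); pose proof (Rmax_r b M).
  specialize (H (Rmin a (-M)) (Rmax b M) ltac:(lra) ltac:(lra)).
  pose proof (RInt_mono_interval f a b (Rmin a (-M)) (Rmax b M) Hp
    (improper_int_ex _ _ HI) ltac:(lra) Hab ltac:(lra)).
  rabs.
Qed.

(** For a nonnegative integrand the value is the supremum over symmetric intervals. Any [[a, b]]
    containing a nearly optimal [[-M, M]] is itself contained in a symmetric interval, hence
    squeezed below the supremum. *)
Lemma improper_int_bounded (f : R -> R) (C : R) :
  (forall x, 0 <= f x) -> (forall a b, ex_RInt f a b) ->
  (forall M, 0 <= M -> RInt f (- M) M <= C) ->
  exists I, improper_int f I /\ I <= C.
Proof.
  intros Hp He HC.
  destruct (completeness (fun v => exists M, 0 <= M /\ v = RInt f (- M) M)) as [I [Hub Hlub]].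
  - exists C; intros v [M [HM ->]]; auto.
  - exists (RInt f (- 0) 0), 0; split; [lra|reflexivity].
  - exists I; split; [|apply Hlub; intros v [M [HM ->]]; auto].
    apply improper_intE; split; [exact He|]; intros eps Heps.
    destruct (classic (exists M, 0 <= M /\ I - eps < RInt f (- M) M)) as [[M [HM HMe]]|Hn].
    + exists M; intros a b Ha Hb.
      pose proof (RInt_mono_interval f (-M) M a b Hp He ltac:(lra) ltac:(lra) ltac:(lra)).
      set (N := Rmax (- a) b).
      pose proof (Rmax_l (-a) b : _ <= N); pose proof (Rmax_r (-a) b : _ <= N).
      pose proof (RInt_mono_interval f a b (-N) N Hp He ltac:(lra) ltac:(lra) ltac:(lra)).
      assert (RInt f (-N) N <= I) by (apply Hub; exists N; split; [lra|reflexivity]).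
      apply Rabs_def1; lra.
    + exfalso; assert (I <= I - eps); [|lra].
      apply Hlub; intros v [M [HM ->]]; apply Rnot_lt_le; intros Hlt.
      apply Hn; exists M; auto.
Qed.

(** Comparison test for signed [f]: the function [f + g] is nonnegative and at most [2 g], so it
    converges, and [g] is subtracted again. Continuity of [f] supplies integrability on bounded
    intervals. *)
Lemma improper_int_dominated (f g : R -> R) (J : R) :
  continuity f -> (forall x, Rabs (f x) <= g x) -> improper_int g J ->
  exists I, improper_int f I /\ Rabs I <= J.
Proof.
  intros Hf Hfg HJ; pose proof (improper_int_ex _ _ HJ) as Eg.
  assert (B : forall x, - g x <= f x <= g x).
  { intros x; specialize (Hfg x); apply Rabs_le_between in Hfg; lra. }
  destruct (improper_int_bounded (fun x => f x + g x) (J + J)) as [I [HI _]].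
  - intros x; specialize (B x); lra.
  - intros a b; apply (ex_RInt_plus f g); [apply cont_ex_RInt, Hf|apply Eg].
  - intros M HM; apply Rle_trans with (RInt (fun x => g x + g x) (-M) M).
    + apply RInt_le; [lra| | |intros x _; specialize (B x); lra].
      * apply (ex_RInt_plus f g); [apply cont_ex_RInt, Hf|apply Eg].
      * apply (ex_RInt_plus g g); apply Eg.
    + apply RInt_le_improper; [|apply improper_int_plus; assumption|lra].
      intros x; specialize (B x); lra.
  - assert (HI' : improper_int f (I - J)).
    { apply (improper_int_ext (fun x => f x + g x - g x)); [intros; ring|].
      apply improper_int_minus; assumption. }
    exists (I - J); split; [exact HI'|].
    apply Rabs_le; split.
    + replace (- J) with ((-1) * J) by ring.
      apply (improper_int_le (fun x => (-1) * g x) f);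
        [intros x; specialize (B x); lra|apply improper_int_scal, HJ|exact HI'].
    + apply (improper_int_le f g); [intros x; apply B|exact HI'|exact HJ].
Qed.

Lemma improper_int_pos (f : R -> R) (I : R) :
  continuity f -> (forall x, 0 < f x) -> improper_int f I -> 0 < I.
Proof.
  intros Hf Hp HI; apply Rlt_le_trans with (RInt f 0 1).
  - apply RInt_gt_0; [lra|auto|]; intros x _; apply continuity_pt_filterlim, Hf.
  - apply RInt_le_improper; [intros x; left; auto|exact HI|lra].
Qed.

Lemma improper_int_shift (f : R -> R) (c I : R) :
  improper_int f I -> improper_int (fun x => f (x + c)) I.
Proof.
  intros HI; pose proof (improper_int_ex _ _ HI) as Ef.
  assert (H : forall a b, is_RInt (fun x => f (x + c)) a b (RInt f (a + c) (b + c))).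
  { intros a b; apply (is_RInt_ext (fun x => scal 1 (f (1 * x + c)))).
    - intros x _; unfold scal; simpl; unfold mult; simpl.
      rewrite !Rmult_1_l; reflexivity.
    - apply (is_RInt_comp_lin f 1 c a b).
      replace (1 * a + c) with (a + c) by ring; replace (1 * b + c) with (b + c) by ring.
      apply RInt_correct_R, Ef. }
  apply improper_intE; split; [intros a b; eexists; apply H|].
  intros eps Heps; destruct (improper_int_near _ _ eps HI Heps) as [M [_ HM]].
  exists (M + Rabs c); intros a b Ha Hb.
  rewrite (is_RInt_unique_R _ _ _ _ (H a b)); apply HM; rabs.
Qed.

Lemma improper_int_opp (f : R -> R) (I : R) :
  improper_int f I -> improper_int (fun x => f (- x)) I.
Proof.
  intros HI; pose proof (improper_int_ex _ _ HI) as Ef.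
  assert (H : forall a b, is_RInt (fun x => f (- x)) a b (RInt f (- b) (- a))).
  { intros a b.
    apply (is_RInt_ext (fun x => scal (-1) (scal (-1) (f (-1 * x + 0))))).
    { intros x _; unfold scal; simpl; unfold mult; simpl.
      replace (-1 * x + 0) with (- x) by ring; ring. }
    assert (H1 : is_RInt f (-1 * a + 0) (-1 * b + 0) (- RInt f (- b) (- a))).
    { replace (-1 * a + 0) with (- a) by ring; replace (-1 * b + 0) with (- b) by ring.
      exact (is_RInt_swap f (- a) (- b) _ (RInt_correct_R _ _ _ (Ef (- b) (- a)))). }
    pose proof (is_RInt_scal _ _ _ (-1) _ (is_RInt_comp_lin f (-1) 0 a b _ H1)) as H2.
    replace (RInt f (- b) (- a)) with (scal (-1) (- RInt f (- b) (- a))); [exact H2|].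
    unfold scal; simpl; unfold mult; simpl; ring. }
  apply improper_intE; split; [intros a b; eexists; apply H|].
  intros eps Heps; destruct (improper_int_near _ _ eps HI Heps) as [M [_ HM]].
  exists M; intros a b Ha Hb.
  rewrite (is_RInt_unique_R _ _ _ _ (H a b)); apply HM; lra.
Qed.

Lemma improper_int_reflect (f : R -> R) (c I : R) :
  improper_int (fun x => f (c - x)) I <-> improper_int f I.
Proof.
  assert (H : forall g, improper_int g I -> improper_int (fun x => g (c - x)) I).
  { intros g Hg; apply (improper_int_ext (fun x => g (- (x + - c))));
      [intros; f_equal; ring|].
    apply (improper_int_shift (fun x => g (- x))), improper_int_opp, Hg. }
  split; [|apply H]; intros HI; apply H in HI.
  refine (improper_int_ext _ _ _ _ HI); intros x; f_equal; ring.
Qed.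

(** Unconditional, even for divergent integrals: both sides apply [epsilon] to the same predicate,
    by extensionality. *)
Lemma Integral_reflect (f : R -> R) (c : R) :
  Integral (fun x => f (c - x)) = Integral f.
Proof.
  unfold Integral; f_equal; apply functional_extensionality; intros I.
  apply propositional_extensionality, improper_int_reflect.
Qed.

Lemma improper_int_nonneg (f : R -> R) (I : R) :
  (forall x, 0 <= f x) -> improper_int f I -> 0 <= I.
Proof.
  intros Hp HI; pose proof (improper_int_scal 0 f I HI) as H0.
  rewrite (Rmult_0_l I) in H0; refine (improper_int_le _ _ _ _ _ H0 HI).
  intros x; specialize (Hp x); lra.
Qed.

(** * Integrals depending on a parameter, and the interchange of integrals *)

Lemma RInt_le_cont (f g : R -> R) (a b : R) :
  a <= b -> continuity f -> continuity g ->
  (forall x, a <= x <= b -> f x <= g x) -> RInt f a b <= RInt g a b.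
Proof.
  intros Hab Hf Hg H; apply RInt_le; [exact Hab|apply cont_ex_RInt; assumption..|].
  intros x Hx; apply H; lra.
Qed.

Lemma RInt_minus_cont (f g : R -> R) (a b : R) :
  continuity f -> continuity g ->
  RInt (fun x => f x - g x) a b = RInt f a b - RInt g a b.
Proof.
  intros Hf Hg.
  exact (RInt_minus f g a b (cont_ex_RInt _ a b Hf) (cont_ex_RInt _ a b Hg)).
Qed.

Lemma cont_RInt_param_le (F : R -> R -> R) (a b : R) :
  a <= b -> cont2 F -> continuity (fun x => RInt (F x) a b).
Proof.
  intros Hab HF x0 eps Heps.
  assert (Hc : forall x, continuity (F x)).
  { intros x; change (continuity (fun t => F x t)); cont_tac. }
  (* The summand 1 keeps the quotient defined for [a = b] and makes the final bound strict. *)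
  assert (He : 0 < eps / (b - a + 1)) by (apply Rdiv_lt_0_compat; lra).
  destruct (uniform_continuity_2d F (x0 - 1) (x0 + 1) a b (fun x t _ _ => HF x t)
    (mkposreal _ He)) as [d Hd]; simpl in Hd.
  exists (Rmin d 1); split; [apply Rmin_pos; [apply cond_pos|lra]|].
  intros x [_ Hx]; simpl in Hx; unfold R_dist in Hx; simpl; unfold R_dist.
  pose proof (Rmin_l d 1); pose proof (Rmin_r d 1).
  rewrite <- RInt_minus_cont by apply Hc.
  eapply Rle_lt_trans; [apply abs_RInt_le_const with (M := eps / (b - a + 1))|].
  - exact Hab.
  - apply cont_ex_RInt, cont_Rminus; apply Hc.
  - intros t Ht; left; apply Hd; [split; lra|lra|split; rabs|lra|lra|].
    rewrite Rminus_diag, Rabs_R0; apply cond_pos.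
  - apply (Rmult_lt_reg_r (b - a + 1)); [lra|]; field_simplify; nra.
Qed.

Lemma RInt_swap_R (f : R -> R) (a b : R) :
  continuity f -> RInt f a b = - RInt f b a.
Proof. intros Hf; symmetry; exact (opp_RInt_swap f b a (cont_ex_RInt f b a Hf)). Qed.

Lemma cont_RInt_param (F : R -> R -> R) (a b : R) :
  cont2 F -> continuity (fun x => RInt (F x) a b).
Proof.
  intros HF; destruct (Rle_lt_dec a b) as [Hab|Hab].
  - apply cont_RInt_param_le; assumption.
  - replace (fun x => RInt (F x) a b) with (fun x => - RInt (F x) b a).
    + apply cont_Ropp, cont_RInt_param_le; [lra|exact HF].
    + apply functional_extensionality; intros x; symmetry; apply RInt_swap_R.
      change (continuity (fun t => F x t)); cont_tac.
Qed.

Lemma is_derive_RInt_cont (f : R -> R) (a b : R) :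
  continuity f -> is_derive (fun z => RInt f a z) b (f b).
Proof.
  intros Hf; apply (is_derive_RInt f (fun z => RInt f a z) a b).
  - apply filter_forall; intros z; apply RInt_correct_R, cont_ex_RInt, Hf.
  - apply continuity_pt_filterlim, Hf.
Qed.

(* Both sides have the same derivative with respect to [b]. *)
Lemma RInt_Fubini (F : R -> R -> R) (a b c d : R) :
  a <= b -> cont2 F ->
  RInt (fun x => RInt (F x) c d) a b = RInt (fun t => RInt (fun x => F x t) a b) c d.
Proof.
  intros Hab HF.
  assert (HFs : forall t, continuity (fun x => F x t)) by (intros t; cont_tac).
  assert (Hd : forall z t, is_derive (fun z => RInt (fun x => F x t) a z) z (F z t)).
  { intros z t; apply (is_derive_RInt_cont (fun x => F x t)), HFs. }
  set (Phi := fun z => RInt (fun x => RInt (F x) c d) a z : R).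
  set (Psi := fun z => RInt (fun t => RInt (fun x => F x t) a z) c d : R).
  assert (HPhi : forall z, is_derive Phi z (RInt (F z) c d)).
  { intros z; apply (is_derive_RInt_cont (fun x => RInt (F x) c d)), cont_RInt_param, HF. }
  assert (HPsi : forall z, is_derive Psi z (RInt (F z) c d)).
  { intros z; replace (RInt (F z) c d) with
      (RInt (fun t => Derive (fun z => RInt (fun x => F x t) a z) z) c d).
    - apply (is_derive_RInt_param (fun z t => RInt (fun x => F x t) a z)).
      + apply filter_forall; intros u t _; eexists; apply Hd.
      + intros t _; apply (continuity_2d_pt_ext F); [|apply HF].
        intros u v; symmetry; apply is_derive_unique, Hd.
      + apply filter_forall; intros u; apply cont_ex_RInt.
        apply (cont_RInt_param (fun t x => F x t)), cont2_swap, HF.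
    - f_equal; apply functional_extensionality; intros t; apply is_derive_unique, Hd. }
  assert (H0 : forall z, is_derive (fun z => minus (Phi z) (Psi z)) z zero).
  { intros z; pose proof (is_derive_minus Phi Psi z _ _ (HPhi z) (HPsi z)) as H3.
    rewrite minus_eq_zero in H3; exact H3. }
  assert (E0 : forall f : R -> R, RInt f a a = 0) by (intros f; exact (RInt_point a f)).
  assert (EP : Psi a = 0).
  { unfold Psi; replace (fun t => RInt (fun x => F x t) a a) with (fun _ : R => 0).
    - transitivity ((d - c) * 0); [exact (RInt_const c d 0)|ring].
    - apply functional_extensionality; intros t; symmetry; apply E0. }
  assert (EPh : Phi a = 0) by apply E0.
  change (Phi b = Psi b).
  destruct (Req_dec a b) as [<-|Hn]; [lra|].
  assert (E : Phi a - Psi a = Phi b - Psi b).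
  { apply (eq_is_derive (fun z => minus (Phi z) (Psi z)) a b); [intros t _; apply H0|lra]. }
  lra.
Qed.

(** A three-epsilon argument: outside a fixed [[-M, M]] all integrals near [x0] are controlled by
    the tail of one dominating [g], and inside it the proper integral is continuous in the
    parameter. Domination is asked only for bounded parameters, which is what [cosh (lam * (z + t))]
    allows. *)
Lemma improper_int_param_cont (F : R -> R -> R) (A : R -> R) :
  cont2 F -> (forall x, improper_int (F x) (A x)) ->
  (forall K, exists g J, improper_int g J /\
     forall x t, Rabs x <= K -> Rabs (F x t) <= g t) ->
  continuity A.
Proof.
  intros HF HA Hdom x0 eps Heps.
  destruct (Hdom (Rabs x0 + 1)) as [g [J [HJ Hg]]].
  pose proof (improper_int_ex _ _ HJ) as Eg.
  assert (Hgp : forall t, 0 <= g t).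
  { intros t; apply Rle_trans with (Rabs (F x0 t)); [apply Rabs_pos|].
    apply Hg; lra. }
  destruct (improper_int_near _ _ (eps / 8) HJ ltac:(lra)) as [M [HM HMJ]].
  assert (Hc : forall x, continuity (F x)).
  { intros x; change (continuity (fun t => F x t)); cont_tac. }
  assert (Htail : forall x, Rabs x <= Rabs x0 + 1 ->
            Rabs (A x - RInt (F x) (-M) M) < eps / 3).
  { intros x Hx.
    destruct (improper_int_near _ _ (eps / 8) (HA x) ltac:(lra)) as [N [HN HNA]].
    pose proof (Rmax_l M N); pose proof (Rmax_r M N); set (b := Rmax M N) in *.
    specialize (HNA (-b) b ltac:(lra) ltac:(lra)).
    pose proof (HMJ (-M) M ltac:(lra) ltac:(lra)).
    pose proof (HMJ (-b) b ltac:(lra) ltac:(lra)).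
    assert (EF : forall u v, ex_RInt (F x) u v) by (intros; apply cont_ex_RInt, Hc).
    assert (Hle : forall u v, u <= v -> Rabs (RInt (F x) u v) <= RInt g u v).
    { intros u v Huv; eapply Rle_trans; [apply abs_RInt_le; auto|].
      apply RInt_le; [exact Huv| |auto|intros t _; apply Hg, Hx].
      apply cont_ex_RInt, (cont_comp Rabs (F x)); [apply Rcontinuity_abs|apply Hc]. }
    pose proof (Hle (-b) (-M) ltac:(lra)); pose proof (Hle M b ltac:(lra)).
    pose proof (RInt_Chasles_R _ _ _ _ (EF (-b) (-M)) (EF (-M) b)).
    pose proof (RInt_Chasles_R _ _ _ _ (EF (-M) M) (EF M b)).
    pose proof (RInt_Chasles_R _ _ _ _ (Eg (-b) (-M)) (Eg (-M) b)).
    pose proof (RInt_Chasles_R _ _ _ _ (Eg (-M) M) (Eg M b)).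
    pose proof (RInt_le_improper g J (-b) b Hgp HJ ltac:(lra)).
    apply Rabs_def1;
      repeat match goal with
      | H : Rabs _ < _ |- _ => apply Rabs_def2 in H
      | H : Rabs _ <= _ |- _ => apply Rabs_le_between in H
      end; lra. }
  destruct (cont_RInt_param F (-M) M HF x0 (eps / 3) ltac:(lra)) as [d [Hd1 Hd]].
  exists (Rmin d 1); split; [apply Rmin_pos; lra|].
  intros x [Dx Hx]; simpl in *; unfold R_dist in *.
  pose proof (Rmin_l d 1); pose proof (Rmin_r d 1).
  assert (Hdx : Rabs (x - x0) < d) by lra.
  specialize (Hd x (conj Dx Hdx)).
  pose proof (Htail x0 ltac:(lra)).
  assert (Hx1 : Rabs x <= Rabs x0 + 1).
  { pose proof (Rabs_triang (x - x0) x0); replace (x - x0 + x0) with x in * by ring; lra. }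
  specialize (Htail x Hx1).
  apply Rabs_def1;
    repeat match goal with
    | H : Rabs _ < _ |- _ => apply Rabs_def2 in H
    end; lra.
Qed.

Lemma choice_function (A B : Type) (P : A -> B -> Prop) :
  (forall x, exists z, P x z) -> exists f : A -> B, forall x, P x (f x).
Proof.
  intros H; exists (fun x => proj1_sig (constructive_indefinite_description _ (H x))).
  intros x; apply proj2_sig.
Qed.

(* Dini's theorem *)
Lemma improper_int_uniform (F : R -> R -> R) (B : R -> R) (c d eps : R) :
  cont2 F -> (forall x t, 0 <= F x t) -> continuity B ->
  (forall t, improper_int (fun x => F x t) (B t)) -> 0 < eps ->
  exists N, 0 <= N /\ forall t, c <= t <= d -> B t - RInt (fun x => F x t) (- N) N < eps.
Proof.
  intros HF Hp HB HI Heps.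
  (* One number [dl] serves both as radius of the neighbourhood and as inverse of the truncation
     level. Shrinking it improves the truncation, so a positive lower bound on the gauge, as
     compactness provides, yields one [N] for the whole interval. *)
  assert (Hloc : forall t, exists dl : posreal, forall s, Rabs (s - t) < dl ->
            B s - RInt (fun x => F x s) (- / dl) (/ dl) < eps).
  { intros t.
    destruct (improper_int_near _ _ (eps / 2) (HI t) ltac:(lra)) as [N [HN HNB]].
    specialize (HNB (-N) N ltac:(lra) ltac:(lra)).
    assert (HC : continuity (fun t => B t - RInt (fun x => F x t) (- N) N)).
    { apply cont_Rminus; [exact HB|].
      apply (cont_RInt_param (fun t x => F x t)), cont2_swap, HF. }
    destruct (HC t (eps / 2) ltac:(lra)) as [dl [Hdl H]].
    assert (Hm : 0 < Rmin dl (/ (N + 1))).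
    { apply Rmin_pos; [lra|apply Rinv_0_lt_compat; lra]. }
    exists (mkposreal _ Hm); simpl; intros s Hs.
    pose proof (Rmin_l dl (/ (N + 1))); pose proof (Rmin_r dl (/ (N + 1))).
    assert (Hs2 : B s - RInt (fun x => F x s) (- N) N < eps).
    { destruct (Req_dec s t) as [->|Hn]; [rabs|].
      assert (Hd : dist R_met (B s - RInt (fun x => F x s) (- N) N)
                     (B t - RInt (fun x => F x t) (- N) N) < eps / 2).
      { apply H; split; [split; [exact I|auto]|simpl; unfold R_dist; lra]. }
      simpl in Hd; unfold R_dist in Hd.
      apply Rabs_def2 in Hd; apply Rabs_def2 in HNB; lra. }
    assert (N + 1 <= / Rmin dl (/ (N + 1))).
    { rewrite <- (Rinv_inv (N + 1)) at 1; apply Rinv_le_contravar; assumption. }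
    pose proof (RInt_mono_interval (fun x => F x s) (-N) N (- / Rmin dl (/ (N + 1)))
      (/ Rmin dl (/ (N + 1))) (fun x => Hp x s) (improper_int_ex _ _ (HI s))
      ltac:(lra) ltac:(lra) ltac:(lra)).
    lra. }
  destruct (choice_function _ _ _ Hloc) as [dl Hdl].
  destruct (compactness_value_1d c d dl) as [d0 Hd0].
  exists (/ d0); split; [left; apply Rinv_0_lt_compat, cond_pos|].
  intros s Hs; specialize (Hd0 s Hs); apply NNPP in Hd0.
  destruct Hd0 as [t [_ [Ht Hle]]]; specialize (Hdl t s Ht).
  pose proof (cond_pos d0); pose proof (cond_pos (dl t)).
  assert (0 < / dl t) by (apply Rinv_0_lt_compat; lra).
  assert (/ dl t <= / d0) by (apply Rinv_le_contravar; lra).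
  pose proof (RInt_mono_interval (fun x => F x s) (- / dl t) (/ dl t) (- / d0) (/ d0)
    (fun x => Hp x s) (improper_int_ex _ _ (HI s)) ltac:(lra) ltac:(lra) ltac:(lra)).
  lra.
Qed.

(** By Dini the inner integral [B] is approximated uniformly on [[c, d]] by integrals over
    [[-N, N]]; on the rectangle the order can be exchanged, and the result is at most the integral
    of [A]. *)
Lemma Tonelli_le (F : R -> R -> R) (A B : R -> R) (I c d : R) :
  cont2 F -> (forall x t, 0 <= F x t) -> continuity A -> continuity B ->
  (forall x, improper_int (F x) (A x)) ->
  (forall t, improper_int (fun x => F x t) (B t)) ->
  improper_int A I -> c <= d -> RInt B c d <= I.
Proof.
  intros HF Hp CA CB HA HB HI Hcd; apply Rnot_lt_le; intros Hlt.
  (* Chosen so that the total error [(d - c) * eps] stays strictly below the supposed gap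
     [RInt B c d - I]. *)
  set (eps := (RInt B c d - I) / (d - c + 1)).
  assert (He : 0 < eps) by (apply Rdiv_lt_0_compat; lra).
  destruct (improper_int_uniform F B c d eps HF Hp CB HB He) as [N [HN HNB]].
  assert (CG : continuity (fun t => RInt (fun x => F x t) (- N) N)).
  { apply (cont_RInt_param (fun t x => F x t)), cont2_swap, HF. }
  assert (H1 : RInt B c d - RInt (fun t => RInt (fun x => F x t) (- N) N) c d
               <= (d - c) * eps).
  { rewrite <- RInt_minus_cont by assumption.
    apply Rle_trans with (RInt (fun _ => eps) c d).
    - apply RInt_le_cont; [exact Hcd|cont_tac|cont_tac|].
      intros t Ht; left; apply HNB, Ht.
    - right; exact (RInt_const c d eps). }
  rewrite <- RInt_Fubini in H1 by (lra || assumption).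
  assert (H2 : RInt (fun x => RInt (F x) c d) (-N) N <= RInt A (-N) N).
  { apply RInt_le_cont; [lra|apply cont_RInt_param, HF|exact CA|].
    intros x _; apply RInt_le_improper; auto. }
  assert (H3 : RInt A (-N) N <= I).
  { apply RInt_le_improper; [|exact HI|lra]; intros x.
    apply (improper_int_nonneg (F x)); auto. }
  assert ((d - c + 1) * eps = RInt B c d - I) by (unfold eps; field; lra).
  lra.
Qed.

(** The one-sided estimate first gives convergence of [B] to some [J <= I]; with the roles of the
    variables exchanged it gives [I <= J]. *)
Lemma Tonelli (F : R -> R -> R) (A B : R -> R) (I : R) :
  cont2 F -> (forall x t, 0 <= F x t) -> continuity A -> continuity B ->
  (forall x, improper_int (F x) (A x)) ->
  (forall t, improper_int (fun x => F x t) (B t)) ->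
  improper_int A I -> improper_int B I.
Proof.
  intros HF Hp CA CB HA HB HI.
  destruct (improper_int_bounded B I) as [J [HJ HJI]].
  - intros t; apply (improper_int_nonneg (fun x => F x t)); auto.
  - intros; apply cont_ex_RInt, CB.
  - intros M HM; apply (Tonelli_le F A B); auto; lra.
  - destruct (improper_int_bounded A J) as [I' [HI' HIJ]].
    + intros x; apply (improper_int_nonneg (F x)); auto.
    + intros; apply cont_ex_RInt, CA.
    + intros M HM; apply (Tonelli_le (fun t x => F x t) B A); auto; [|lra].
      apply cont2_swap, HF.
    + rewrite (improper_int_unique _ _ _ HI' HI) in HIJ.
      replace I with J by lra; exact HJ.
Qed.

(** * Harris' theorem *)

(** The sign of [r] is left free because radii come out of the existential in [drift]; for [r < 0]
    the hypothesis forces [f = 0], and both sides vanish. *)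
Lemma improper_int_compact_support (f : R -> R) (r : R) :
  continuity f -> (forall x, r <= Rabs x -> f x = 0) ->
  improper_int f (RInt f (- r) r).
Proof.
  intros Hf H0; apply improper_intE.
  split; [intros; apply cont_ex_RInt, Hf|]; intros eps Heps.
  assert (Hz : forall a b, (forall x, Rmin a b < x < Rmax a b -> r <= Rabs x) ->
            RInt f a b = 0).
  { intros a b H; transitivity ((b - a) * 0); [|apply Rmult_0_r].
    rewrite (RInt_ext f (fun _ => 0)) by (intros x Hx; apply H0, H, Hx).
    exact (RInt_const a b 0). }
  exists (Rabs r); intros a b Ha Hb.
  rewrite <- (RInt_Chasles_R f a (-r) b), <- (RInt_Chasles_R f (-r) r b)
    by (apply cont_ex_RInt, Hf).
  rewrite (Hz a (-r)), (Hz r b).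
  - replace (0 + (RInt f (- r) r + 0) - RInt f (- r) r) with 0 by ring.
    rewrite Rabs_R0; exact Heps.
  - intros x; rewrite Rmin_left, Rmax_right by rabs; intros; rabs.
  - intros x; rewrite Rmin_left, Rmax_right by rabs; intros; rabs.
Qed.

(** A bounded continuous kernel sends absolutely integrable continuous functions to continuous ones,
    dominated by [Bd * |h|]. This keeps all iterates of the chain inside the class where Tonelli
    applies. *)
Lemma kernel_image (D : R -> R -> R) (Bd : R) (h : R -> R) (c : R) :
  cont2 D -> (forall t t', 0 <= D t t' <= Bd) ->
  continuity h -> improper_int (fun t => Rabs (h t)) c ->
  (forall t', improper_int (fun t => h t * D t t') (Integral (fun t => h t * D t t'))) /\
  continuity (fun t' => Integral (fun t => h t * D t t')).
Proof.
  intros HD HB Hh Hc.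
  assert (Hdom : forall t t', Rabs (h t * D t t') <= Bd * Rabs (h t)).
  { intros t t'; rewrite Rabs_mult, (Rabs_pos_eq (D t t')), Rmult_comm by apply HB.
    apply Rmult_le_compat_r; [apply Rabs_pos|apply HB]. }
  assert (HI : forall t', improper_int (fun t => h t * D t t')
                 (Integral (fun t => h t * D t t'))).
  { intros t'; destruct (improper_int_dominated (fun t => h t * D t t')
      (fun t => Bd * Rabs (h t)) (Bd * c)) as [I [HI _]].
    - cont_tac.
    - intros t; apply Hdom.
    - apply improper_int_scal, Hc.
    - rewrite (Integral_eq _ _ HI); exact HI. }
  split; [exact HI|].
  apply (improper_int_param_cont (fun t' t => h t * D t t')); [|exact HI|].
  - cont_tac.
  - intros K; exists (fun t => Bd * Rabs (h t)), (Bd * c).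
    split; [apply improper_int_scal, Hc|intros; apply Hdom].
Qed.

(** The duality between measures and functions, [(p D) W = p (D W)]: a weighted norm of the image
    becomes an integral against [p], where pointwise drift bounds can be used. *)
Lemma kernel_image_weight (D : R -> R -> R) (Bd : R) (W DW p : R -> R) (c I : R) :
  cont2 D -> (forall t t', 0 <= D t t' <= Bd) ->
  continuity W -> (forall t, 0 <= W t) -> continuity DW ->
  (forall t, improper_int (fun t' => D t t' * W t') (DW t)) ->
  continuity p -> (forall t, 0 <= p t) -> improper_int p c ->
  improper_int (fun t => p t * DW t) I ->
  improper_int (fun t' => Integral (fun t => p t * D t t') * W t') I.
Proof.
  intros HD HB HW HWp HDW HI Hp Hpp Hc H.
  destruct (kernel_image D Bd p c HD HB Hp) as [HQ CQ].
  { refine (improper_int_ext _ _ _ _ Hc); intros t; rewrite Rabs_pos_eq; auto. }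
  apply (Tonelli (fun t t' => p t * D t t' * W t') (fun t => p t * DW t)); auto.
  - cont_tac.
  - intros t t'; repeat apply Rmult_le_pos; auto; apply HB.
  - cont_tac.
  - set (q := fun t' => Integral (fun t => p t * D t t')) in *.
    change (continuity (fun t' => q t' * W t')); cont_tac.
  - intros t; refine (improper_int_ext _ _ _ _ (improper_int_scal (p t) _ _ (HI t))).
    intros; simpl; ring.
  - intros t'; set (q := Integral (fun t => p t * D t t')) in *.
    rewrite (Rmult_comm q).
    refine (improper_int_ext _ _ _ _ (improper_int_scal (W t') _ _ (HQ t'))).
    intros; simpl; ring.
Qed.

(* With [h] of zero mass, [h K = h (K - s nu) + (int h s) nu] and
   [int h s = - int h (eps - s)]: on the small set, where [s = eps], the
   minorised part of the kernel is cancelled. *)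
Lemma minorised_kernel_contraction (K : R -> R -> R) (Bd : R) (W PW s nu : R -> R)
    (nuW eps alpha : R) (h : R -> R) (c : R) :
  cont2 K -> (forall t t', 0 <= K t t' <= Bd) ->
  continuity W -> (forall t, 1 <= W t) -> continuity PW ->
  (forall t, improper_int (fun t' => K t t' * W t') (PW t)) ->
  continuity s -> (forall t, 0 <= s t <= eps) ->
  continuity nu -> (forall t, 0 <= nu t) ->
  improper_int (fun t => nu t * W t) nuW ->
  (forall t t', s t * nu t' <= K t t') ->
  (forall t, PW t - 2 * (s t * nuW) + eps * nuW <= alpha * W t) ->
  continuity h -> improper_int h 0 -> improper_int (fun t => W t * Rabs (h t)) c ->
  exists c', improper_int (fun t' => W t' * Rabs (Integral (fun t => h t * K t t'))) c' /\
    c' <= alpha * c.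
Proof.
  intros HK HB CW HW CPW HPW Cs Hs Cnu Hnu HnuW Hmin Hdr Ch H0 Hc.
  assert (Wh : forall t, Rabs (h t) <= W t * Rabs (h t)).
  { intros t; pose proof (Rabs_pos (h t)); specialize (HW t); nra. }
  assert (HnuWp : 0 <= nuW).
  { refine (improper_int_nonneg _ _ _ HnuW); intros t.
    apply Rmult_le_pos; [auto|specialize (HW t); lra]. }
  destruct (improper_int_dominated (fun t => Rabs (h t)) (fun t => W t * Rabs (h t)) c)
    as [a0 [Ha0 _]]; [cont_tac|intros t; rewrite Rabs_Rabsolu; apply Wh|exact Hc|].
  set (D := fun t t' => K t t' - s t * nu t').
  assert (CD : cont2 D) by (unfold D; cont_tac).
  assert (HD : forall t t', 0 <= D t t' <= Bd).
  { intros t t'; unfold D; specialize (Hmin t t'); specialize (HB t t').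
    pose proof (Rmult_le_pos _ _ (proj1 (Hs t)) (Hnu t')); lra. }
  set (DW := fun t => PW t - s t * nuW).
  assert (CDW : continuity DW) by (unfold DW; cont_tac).
  assert (HDW : forall t, improper_int (fun t' => D t t' * W t') (DW t)).
  { intros t.
    refine (improper_int_ext _ _ _ _ (improper_int_minus _ _ _ _ (HPW t)
      (improper_int_scal (s t) _ _ HnuW))).
    intros t'; unfold D; simpl; ring. }
  assert (HWp : forall t, 0 <= W t) by (intros t; specialize (HW t); lra).
  assert (HDWp : forall t, 0 <= DW t).
  { intros t; refine (improper_int_nonneg _ _ _ (HDW t)); intros t'.
    apply Rmult_le_pos; [apply HD|apply HWp]. }
  (* The two costs per unit of [|h|]: [DW] from the residual kernel, and [nuW * (eps - s)] from the
     rank-one part, whose coefficient is [- int h (eps - s)]. Each contains [- s * nuW], hence the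
     factor 2 in the hypothesis. *)
  assert (HDWle : forall t, DW t + nuW * (eps - s t) <= alpha * W t).
  { intros t; unfold DW; specialize (Hdr t); lra. }
  assert (HDWle' : forall t, DW t <= alpha * W t).
  { intros t; specialize (HDWle t); specialize (Hs t); nra. }
  destruct (improper_int_dominated (fun t => Rabs (h t) * DW t)
    (fun t => alpha * (W t * Rabs (h t))) (alpha * c)) as [I1 [HI1 _]].
  { cont_tac. }
  { intros t; pose proof (Rabs_pos (h t)).
    rewrite Rabs_pos_eq by (apply Rmult_le_pos; auto).
    specialize (HDWle' t); nra. }
  { apply improper_int_scal, Hc. }
  set (B1 := fun t' => Integral (fun t => Rabs (h t) * D t t')).
  assert (Cah : continuity (fun t => Rabs (h t))) by cont_tac.
  assert (Haa : improper_int (fun t => Rabs (Rabs (h t))) a0).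
  { refine (improper_int_ext _ _ _ _ Ha0); intros t; rewrite Rabs_Rabsolu; reflexivity. }
  destruct (kernel_image D Bd (fun t => Rabs (h t)) a0 CD HD Cah Haa) as [HB1 _].
  assert (HB1W : improper_int (fun t' => B1 t' * W t') I1).
  { apply (kernel_image_weight D Bd W DW (fun t => Rabs (h t)) a0); auto.
    intros t; apply Rabs_pos. }
  destruct (improper_int_dominated (fun t => Rabs (h t) * (eps - s t))
    (fun t => eps * Rabs (h t)) (eps * a0)) as [e [He _]].
  { cont_tac. }
  { intros t; pose proof (Rabs_pos (h t)); specialize (Hs t).
    rewrite Rabs_pos_eq; nra. }
  { apply improper_int_scal, Ha0. }
  destruct (improper_int_dominated (fun t => h t * (eps - s t))
    (fun t => Rabs (h t) * (eps - s t)) e) as [e1 [He1 He1e]].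
  { cont_tac. }
  { intros t; specialize (Hs t); rewrite Rabs_mult, (Rabs_pos_eq (eps - s t)); lra. }
  { exact He. }
  assert (Hhs : improper_int (fun t => h t * s t) (- e1)).
  { replace (- e1) with (eps * 0 - e1) by ring.
    refine (improper_int_ext _ _ _ _ (improper_int_minus _ _ _ _
      (improper_int_scal eps _ _ H0) He1)); intros t; simpl; ring. }
  destruct (kernel_image K Bd h a0 HK HB Ch Ha0) as [HQ CQ].
  set (Q := fun t' => Integral (fun t => h t * K t t')) in *.
  assert (HQB : forall t', Rabs (Q t') <= B1 t' + e * nu t').
  { intros t'.
    assert (HhD : improper_int (fun t => h t * D t t') (Q t' - nu t' * (- e1))).
    { refine (improper_int_ext _ _ _ _ (improper_int_minus _ _ _ _ (HQ t')
        (improper_int_scal (nu t') _ _ Hhs))); intros t; unfold D; simpl; ring. }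
    destruct (improper_int_dominated (fun t => h t * D t t')
      (fun t => Rabs (h t) * D t t') (B1 t')) as [I2 [HI2 HI2B]].
    { cont_tac. }
    { intros t; rewrite Rabs_mult, (Rabs_pos_eq (D t t')); [lra|apply HD]. }
    { apply HB1. }
    rewrite (improper_int_unique _ _ _ HI2 HhD) in HI2B.
    apply Rabs_le_between in HI2B; apply Rabs_le_between in He1e.
    specialize (Hnu t'); apply Rabs_le; split; nra. }
  destruct (improper_int_dominated (fun t' => W t' * Rabs (Q t'))
    (fun t' => B1 t' * W t' + e * (nu t' * W t')) (I1 + e * nuW)) as [c' [Hc' Hc'le]].
  { cont_tac. }
  { intros t'; specialize (HQB t'); specialize (HWp t'); pose proof (Rabs_pos (Q t')).
    rewrite Rabs_pos_eq; nra. }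
  { apply improper_int_plus; [exact HB1W|apply improper_int_scal, HnuW]. }
  exists c'; split; [exact Hc'|].
  apply Rle_trans with (I1 + nuW * e).
  - apply Rabs_le_between in Hc'le; lra.
  - refine (improper_int_le _ _ _ _ _ (improper_int_plus _ _ _ _ HI1
      (improper_int_scal nuW _ _ He)) (improper_int_scal alpha _ _ Hc)).
    intros t; simpl; specialize (HDWle t); pose proof (Rabs_pos (h t)); nra.
Qed.

(** Written through [Rabs] rather than [Rmax] so that continuity is immediate. *)
Definition pos_part (x : R) : R := (x + Rabs x) / 2.

Lemma pos_partE (x : R) : pos_part x = Rmax 0 x.
Proof. unfold pos_part, Rmax; destruct Rle_dec; rabs. Qed.

Lemma cont_pos_part (f : R -> R) : continuity f -> continuity (fun x => pos_part (f x)).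
Proof. intros Hf; unfold pos_part; cont_tac; intros _; lra. Qed.

(** The minorising probability density: a normalised hat on [[-1, 1]]. An indicator would leave the
    class of continuous functions. *)
Lemma unit_bump : exists nu, continuity nu /\ (forall t, 0 <= nu t) /\
  (forall t, 1 <= Rabs t -> nu t = 0) /\ (exists C, 0 < C /\ forall t, nu t <= C) /\
  improper_int nu 1.
Proof.
  set (hat := fun t => pos_part (1 - Rabs t)).
  assert (Ch : continuity hat) by (apply cont_pos_part; cont_tac).
  assert (Hp : forall t, 0 <= hat t <= 1).
  { intros t; unfold hat; rewrite pos_partE; pose proof (Rabs_pos t).
    unfold Rmax; destruct Rle_dec; lra. }
  assert (Hz : forall t, 1 <= Rabs t -> hat t = 0).
  { intros t Ht; unfold hat; rewrite pos_partE; unfold Rmax; destruct Rle_dec; lra. }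
  pose proof (improper_int_compact_support hat 1 Ch Hz) as Hn.
  set (n0 := RInt hat (- (1)) 1 : R) in *.
  assert (Hn0 : 0 < n0).
  { unfold n0; apply RInt_gt_0; [lra| |intros; apply continuity_pt_filterlim, Ch].
    intros t Ht; unfold hat; rewrite pos_partE.
    assert (Rabs t < 1) by (apply Rabs_def1; lra).
    unfold Rmax; destruct Rle_dec; lra. }
  assert (Hi : 0 < / n0) by (apply Rinv_0_lt_compat, Hn0).
  exists (fun t => / n0 * hat t); split; [|split; [|split; [|split]]].
  - cont_tac.
  - intros t; apply Rmult_le_pos; [lra|apply Hp].
  - intros t Ht; rewrite Hz by exact Ht; ring.
  - exists (/ n0); split; [exact Hi|]; intros t; specialize (Hp t); nra.
  - pose proof (improper_int_scal (/ n0) _ _ Hn) as H.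
    rewrite Rinv_l in H by lra; exact H.
Qed.

(** The last clause makes every bounded set small; the bound 1 on [t'] is the support of the
    minorising bump. *)
Definition markov_kernel (K : R -> R -> R) : Prop :=
  cont2 K /\ (exists Bd, forall t t', 0 <= K t t' <= Bd) /\
  (forall t, improper_int (K t) 1) /\
  (forall rho, exists e, 0 < e /\
     forall t t', Rabs t <= rho -> Rabs t' <= 1 -> e <= K t t').

(** [PV] is the image of [V] under the kernel, passed as an argument so that its convergence and
    continuity belong to the condition. The growth clause says that sublevel sets of [V] are
    bounded, hence small. *)
Definition drift (K : R -> R -> R) (V PV : R -> R) (gam kap : R) : Prop :=
  continuity V /\ (forall t, 1 <= V t) /\
  (forall L, exists rho, forall t, rho <= Rabs t -> L <= V t) /\
  continuity PV /\ (forall t, improper_int (fun t' => K t t' * V t') (PV t)) /\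
  0 <= gam < 1 /\ 0 < kap /\ (forall t, PV t <= gam * V t + kap).

(** Adding [beta * V] to the weight lets both mechanisms act in one norm: near the origin the
    minorisation contracts the constant part, far away the drift contracts [beta * V] by enough to
    pay for the rest. *)
Lemma harris_contraction (K : R -> R -> R) (V PV : R -> R) (gam kap : R) :
  markov_kernel K -> drift K V PV gam kap ->
  exists beta alpha, 0 < beta /\ 0 < alpha < 1 /\
    forall h c, continuity h -> improper_int h 0 ->
      improper_int (fun t => (1 + beta * V t) * Rabs (h t)) c ->
      exists c', improper_int (fun t' => (1 + beta * V t') *
                   Rabs (Integral (fun t => h t * K t t'))) c' /\
        c' <= alpha * c.
Proof.
  intros [HK [[Bd HB] [H1 Hsmall]]] [CV [HV [Hgrow [CPV [HPV [Hgam [Hkap Hdr]]]]]]].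
  destruct unit_bump as [nu [Cnu [Hnu [Hnuz [[C [HC HnuC]] Hnu1]]]]].
  assert (CnuV : continuity (fun t => nu t * V t)) by cont_tac.
  pose proof (improper_int_compact_support (fun t => nu t * V t) 1 CnuV) as HnuV.
  set (nuV := RInt (fun t => nu t * V t) (- (1)) 1 : R) in *.
  specialize (HnuV ltac:(intros x Hx; cbn; rewrite Hnuz by exact Hx; ring)).
  assert (HnuV1 : 1 <= nuV).
  { refine (improper_int_le _ _ _ _ _ Hnu1 HnuV).
    intros t; specialize (HV t); specialize (Hnu t); nra. }
  (* Beyond [rho] the cutoff is merely known to be nonnegative. There [beta * V * (1 - gam) >= 12 *
     beta * kap = 6 * eps], and half of it, [3 * eps], covers the excess [2 * eps] together with the
     [eps / 2] by which [alpha] may fall below 1. *)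
  destruct (Hgrow (12 * kap / (1 - gam))) as [rho Hrho].
  destruct (Hsmall (rho + 1)) as [e0 [He0 He]].
  (* The bound [eps <= 1] keeps [alpha] positive, [eps * C <= e0] gives the minorisation, and
     [eps * nuV <= kap] gives [beta * nuV <= / 2]. *)
  set (eps := Rmin 1 (Rmin (e0 / C) (kap / nuV))).
  assert (Heps : 0 < eps).
  { repeat apply Rmin_pos; [lra|apply Rdiv_lt_0_compat; lra..]. }
  assert (Heps1 : eps <= 1) by apply Rmin_l.
  assert (HepsC : eps * C <= e0).
  { assert (eps <= e0 / C)
      by (eapply Rle_trans; [apply Rmin_r|apply Rmin_l]).
    apply Rle_trans with (e0 / C * C); [apply Rmult_le_compat_r; lra|].
    right; field; lra. }
  assert (HepsV : eps * nuV <= kap).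
  { assert (eps <= kap / nuV)
      by (eapply Rle_trans; [apply Rmin_r|apply Rmin_r]).
    apply Rle_trans with (kap / nuV * nuV); [apply Rmult_le_compat_r; lra|].
    right; field; lra. }
  (* With this weight the additive constant of the drift costs exactly [eps / 2], half of what the
     minorisation gains on the small set. *)
  set (beta := eps / (2 * kap)).
  assert (Hbeta : 0 < beta) by (apply Rdiv_lt_0_compat; lra).
  assert (Hbk : beta * kap = eps / 2) by (unfold beta; field; lra).
  assert (HbnuV : beta * nuV <= / 2).
  { apply (Rmult_le_reg_r kap); [lra|].
    replace (beta * nuV * kap) with (eps * nuV / 2); [lra|].
    unfold beta; field; lra. }
  set (alpha := Rmax (1 - eps / 2) ((1 + gam) / 2)).
  assert (Ha1 : 1 - eps / 2 <= alpha) by apply Rmax_l.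
  assert (Ha2 : (1 + gam) / 2 <= alpha) by apply Rmax_r.
  assert (Ha3 : alpha < 1) by (apply Rmax_lub_lt; lra).
  exists beta, alpha; split; [exact Hbeta|]; split; [lra|].
  intros h c Ch H0 Hc.
  (* A continuous cutoff descending from 1 to 0 between [rho] and [rho + 1]; the lower bound on the
     kernel was therefore taken at radius [rho + 1]. *)
  set (clip := fun t => pos_part (rho + 1 - Rabs t) - pos_part (rho - Rabs t)).
  assert (Cclip : continuity clip).
  { apply (cont_Rminus (fun t => pos_part (rho + 1 - Rabs t))
      (fun t => pos_part (rho - Rabs t))); apply cont_pos_part; cont_tac. }
  assert (Hclip : forall t, 0 <= clip t <= 1 /\ (Rabs t <= rho -> clip t = 1) /\
                    (rho + 1 < Rabs t -> clip t = 0)).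
  { intros t; unfold clip; rewrite !pos_partE; unfold Rmax.
    repeat destruct Rle_dec; repeat split; lra. }
  apply (minorised_kernel_contraction K Bd (fun t => 1 + beta * V t)
    (fun t => 1 + beta * PV t) (fun t => eps * clip t) nu (1 + beta * nuV) eps);
    auto.
  - cont_tac.
  - intros t; specialize (HV t); nra.
  - cont_tac.
  - intros t; refine (improper_int_ext _ _ _ _ (improper_int_plus _ _ _ _ (H1 t)
      (improper_int_scal beta _ _ (HPV t)))); intros t'; simpl; ring.
  - cont_tac.
  - intros t; destruct (Hclip t) as [? _]; nra.
  - refine (improper_int_ext _ _ _ _ (improper_int_plus _ _ _ _ Hnu1
      (improper_int_scal beta _ _ HnuV))); intros t'; simpl; ring.
  - intros t t'; destruct (Hclip t) as [Hcl [_ Hcl0]].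
    destruct (Rlt_le_dec (rho + 1) (Rabs t)) as [Ht|Ht].
    { rewrite Hcl0, Rmult_0_r, Rmult_0_l by exact Ht; apply HB. }
    destruct (Rle_lt_dec 1 (Rabs t')) as [Ht'|Ht'].
    { rewrite (Hnuz t') by exact Ht'; rewrite Rmult_0_r; apply HB. }
    apply Rle_trans with e0; [|apply He; lra].
    apply Rle_trans with (eps * C); [|lra].
    apply Rmult_le_compat; [apply Rmult_le_pos; lra|auto| |auto].
    rewrite <- (Rmult_1_r eps) at 2; apply Rmult_le_compat_l; lra.
  - intros t; specialize (HV t); specialize (Hdr t); destruct (Hclip t) as [Hcl [Hcl1 _]].
    assert (HPVb : beta * PV t <= beta * gam * V t + eps / 2).
    { rewrite <- Hbk; nra. }
    assert (Hbg : beta * gam * V t <= alpha * (beta * V t)).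
    { assert (0 <= beta * V t) by nra; nra. }
    destruct (Rle_lt_dec (Rabs t) rho) as [Ht|Ht].
    + rewrite Hcl1 by exact Ht; assert (0 <= eps * (beta * nuV)) by (apply Rmult_le_pos; nra).
      nra.
    + assert (HVL : 12 * kap / (1 - gam) <= V t) by (apply Hrho; lra).
      assert (HbV : 6 * eps <= beta * V t * (1 - gam)).
      { assert (H12 : 12 * kap <= V t * (1 - gam)).
        { apply Rle_trans with (12 * kap / (1 - gam) * (1 - gam)).
          - right; field; lra.
          - apply Rmult_le_compat_r; lra. }
        assert (beta * (12 * kap) <= beta * (V t * (1 - gam)))
          by (apply Rmult_le_compat_l; lra).
        lra. }
      assert (0 <= eps * clip t * (1 + beta * nuV)).
      { apply Rmult_le_pos; nra. }
      assert (eps * (beta * nuV) <= eps * / 2) by (apply Rmult_le_compat_l; lra).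
      assert ((1 + gam) / 2 * (beta * V t) <= alpha * (beta * V t)).
      { apply Rmult_le_compat_r; nra. }
      lra.
Qed.

(* Integrating the drift condition against [pi] needs [V] to be integrable
   first; test with the compactly supported [w = max(N - V, 0)] instead, which
   satisfies [P w >= max(N - kap - gam V, 0)]. *)
Lemma stationary_drift_integrable (K : R -> R -> R) (V PV : R -> R) (gam kap : R)
    (pi : R -> R) :
  markov_kernel K -> drift K V PV gam kap ->
  continuity pi -> (forall t, 0 <= pi t) -> improper_int pi 1 ->
  (forall t', improper_int (fun t => pi t * K t t') (pi t')) ->
  exists c, improper_int (fun t => pi t * V t) c.
Proof.
  intros [HK [[Bd HB] [H1 _]]] [CV [HV [Hgrow [CPV [HPV [Hgam [Hkap Hdr]]]]]]].
  intros Cpi Hpi Hpi1 Hinv.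
  destruct (improper_int_bounded (fun t => pi t * V t) (kap / (1 - gam)))
    as [c [Hc _]]; [| | |exists c; exact Hc].
  { intros t; specialize (HV t); apply Rmult_le_pos; [auto|lra]. }
  { intros a b; apply cont_ex_RInt; cont_tac. }
  intros A HA.
  (* The truncation level is the maximum of [V] on [[-A, A]], so that [w = N - V] on that interval.
     The bound obtained, [kap / (1 - gam)], does not depend on [A]. *)
  destruct (continuity_ab_maj V (-A) A ltac:(lra) ltac:(auto)) as [xm [Hxm _]].
  set (N := V xm) in *.
  assert (HN : 1 <= N) by apply HV.
  set (w := fun t => pos_part (N - V t)).
  set (u := fun t => pos_part (N - kap - gam * V t)).
  assert (Cw : continuity w) by (apply cont_pos_part; cont_tac).
  assert (Cu : continuity u) by (apply cont_pos_part; cont_tac).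
  assert (Hw : forall t, 0 <= w t /\ N - V t <= w t <= N /\ (N <= V t -> w t = 0)).
  { intros t; specialize (HV t); unfold w; rewrite pos_partE; unfold Rmax.
    destruct Rle_dec; repeat split; lra. }
  assert (Hu : forall t, 0 <= u t <= N /\ N - kap - gam * V t <= u t /\
                 (forall b, 0 <= b -> N - kap - gam * V t <= b -> u t <= b)).
  { intros t; specialize (HV t).
    assert (0 <= gam * V t) by (apply Rmult_le_pos; lra).
    unfold u; rewrite pos_partE; unfold Rmax.
    destruct Rle_dec; repeat split; intros; lra. }
  destruct (Hgrow N) as [rho Hrho].
  pose proof (improper_int_compact_support w rho Cw) as Hwi.
  specialize (Hwi ltac:(intros; apply Hw; auto)).
  set (Pw := fun t => Integral (fun t' => K t t' * w t')).
  assert (Hdom : forall t t', Rabs (K t t' * w t') <= Bd * w t').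
  { intros t t'; specialize (HB t t'); destruct (Hw t') as [? _].
    rewrite Rabs_pos_eq by (apply Rmult_le_pos; lra); nra. }
  assert (HPw : forall t, improper_int (fun t' => K t t' * w t') (Pw t)).
  { intros t; destruct (improper_int_dominated (fun t' => K t t' * w t')
      (fun t' => Bd * w t') _ ltac:(cont_tac) (Hdom t)
      (improper_int_scal Bd _ _ Hwi)) as [I [HI _]].
    unfold Pw; rewrite (Integral_eq _ _ HI); exact HI. }
  assert (CPw : continuity Pw).
  { apply (improper_int_param_cont (fun t t' => K t t' * w t')); [cont_tac|exact HPw|].
    intros L; exists (fun t' => Bd * w t'); eexists.
    split; [apply improper_int_scal, Hwi|auto]. }
  (* Since [K t] has mass 1 and [w >= N - V], the image is at least [N - PV t], to which the drift
     bound applies; it is also nonnegative, which accounts for the positive part in [u]. *)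
  assert (HPwu : forall t, u t <= Pw t).
  { intros t; apply Hu.
    - refine (improper_int_nonneg _ _ _ (HPw t)); intros t'.
      apply Rmult_le_pos; [apply HB|apply Hw].
    - apply Rle_trans with (N * 1 - PV t); [specialize (Hdr t); lra|].
      refine (improper_int_le _ _ _ _ _ (improper_int_minus _ _ _ _
        (improper_int_scal N _ _ (H1 t)) (HPV t)) (HPw t)).
      intros t'; simpl; destruct (Hw t') as [_ [? _]]; specialize (HB t t'); nra. }
  destruct (improper_int_dominated (fun t => pi t * w t) (fun t => N * pi t) (N * 1))
    as [J [HJ _]]; [cont_tac| |apply improper_int_scal, Hpi1|].
  { intros t; destruct (Hw t) as [? [? _]]; specialize (Hpi t).
    rewrite Rabs_pos_eq by (apply Rmult_le_pos; lra); nra. }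
  destruct (improper_int_dominated (fun t => pi t * u t) (fun t => N * pi t) (N * 1))
    as [J' [HJ' _]]; [cont_tac| |apply improper_int_scal, Hpi1|].
  { intros t; destruct (Hu t) as [? _]; specialize (Hpi t).
    rewrite Rabs_pos_eq by (apply Rmult_le_pos; lra); nra. }
  assert (HJP : improper_int (fun t => pi t * Pw t) J).
  { apply (Tonelli (fun t' t => pi t * K t t' * w t') (fun t' => pi t' * w t')); auto.
    - assert (cont2 (fun t' t => K t t')) by cont_tac; cont_tac.
    - intros t' t; apply Rmult_le_pos; [apply Rmult_le_pos; [auto|apply HB]|apply Hw].
    - cont_tac.
    - cont_tac.
    - intros t'; rewrite Rmult_comm.
      refine (improper_int_ext _ _ _ _ (improper_int_scal (w t') _ _ (Hinv t'))).
      intros; simpl; ring.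
    - intros t.
      refine (improper_int_ext _ _ _ _ (improper_int_scal (pi t) _ _ (HPw t))).
      intros; simpl; ring. }
  assert (HJJ : J' <= J).
  { refine (improper_int_le _ _ _ _ _ HJ' HJP); intros t.
    apply Rmult_le_compat_l; auto. }
  pose proof (improper_int_minus _ _ _ _ (improper_int_scal kap _ _ Hpi1)
    (improper_int_minus _ _ _ _ HJ HJ')) as Hg; simpl in Hg.
  (* [g] is nonnegative because [w - u <= kap]; its integral [kap - (J - J')] is at most [kap] by
     invariance; and on [[-A, A]] it dominates [(1 - gam) * pi * V]. *)
  set (g := fun t => kap * pi t - (pi t * w t - pi t * u t)) in *.
  assert (Hwu : forall t, w t - u t <= kap).
  { intros t; destruct (Hw t) as [? [? Hw0]]; destruct (Hu t) as [? [? _]]; specialize (HV t).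
    destruct (Rle_lt_dec N (V t)) as [Hl|Hl]; [rewrite Hw0 by exact Hl; lra|].
    assert (gam * V t <= V t) by nra.
    unfold w in *; rewrite pos_partE in *; unfold Rmax in *; destruct Rle_dec; lra. }
  assert (Hgp : forall t, 0 <= g t).
  { intros t; specialize (Hwu t); specialize (Hpi t); unfold g; nra. }
  pose proof (RInt_le_improper _ _ (-A) A Hgp Hg ltac:(lra)) as HgA.
  assert (Hle : RInt (fun t => (1 - gam) * (pi t * V t)) (-A) A <= RInt g (-A) A).
  { apply RInt_le_cont; [lra|cont_tac|unfold g; cont_tac|].
    intros t Ht; specialize (Hxm t Ht); fold N in Hxm; unfold g.
    assert (Hwe : w t = N - V t).
    { unfold w; rewrite pos_partE; unfold Rmax; destruct Rle_dec; lra. }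
    destruct (Hu t) as [_ [? _]]; specialize (Hpi t); rewrite Hwe; nra. }
  assert (E : RInt (fun t => (1 - gam) * (pi t * V t)) (-A) A =
              (1 - gam) * RInt (fun t => pi t * V t) (-A) A).
  { assert (CpV : continuity (fun t => pi t * V t)) by cont_tac.
    exact (RInt_scal (fun t => pi t * V t) (-A) A (1 - gam) (cont_ex_RInt _ _ _ CpV)). }
  apply (Rmult_le_reg_l (1 - gam)); [lra|].
  replace ((1 - gam) * (kap / (1 - gam))) with kap by (field; lra).
  lra.
Qed.

(** The error [h_m = step_dens - pi] has zero mass, and invariance of [pi] gives [h_(m+1) = h_m K],
    so its weighted norm shrinks by [alpha] at each step. It is finite at the start because [V] is
    integrable under both [K th0] and [pi]; it dominates the total variation distance because the
    weight is at least 1. *)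
Lemma drift_geom_ergodic (g : R -> R -> R) (V PV : R -> R) (gam kap : R) :
  markov_kernel (kern g) -> drift (kern g) V PV gam kap ->
  continuity (post g) -> (forall t, 0 <= post g t) -> improper_int (post g) 1 ->
  (forall t', improper_int (fun t => post g t * kern g t t') (post g t')) ->
  geom_ergodic g.
Proof.
  intros HM HD Cpi Hpi Hpi1 Hinv.
  destruct (stationary_drift_integrable _ _ _ _ _ _ HM HD Cpi Hpi Hpi1 Hinv) as [cV HcV].
  destruct (harris_contraction _ _ _ _ _ HM HD) as [beta [alpha [Hbeta [Halpha Hcontr]]]].
  destruct HM as [HK [[Bd HB] [H1 _]]].
  destruct HD as [CV [HV [_ [_ [HPV _]]]]].
  set (K := kern g) in *; set (pi := post g) in *.
  assert (Hp : forall th0 m, continuity (step_dens g th0 m) /\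
            (forall t, 0 <= step_dens g th0 m t) /\ improper_int (step_dens g th0 m) 1).
  { intros th0; induction m as [|m [Cp [Hp Hp1]]].
    - cbn [step_dens]; fold K; split; [|split; [intros t; apply HB|apply H1]].
      change (continuity (fun t => K th0 t)); cont_tac.
    - set (p := step_dens g th0 m) in *.
      assert (Habs : improper_int (fun t => Rabs (p t)) 1).
      { refine (improper_int_ext _ _ _ _ Hp1); intros t; rewrite Rabs_pos_eq; auto. }
      destruct (kernel_image K Bd p 1 HK HB Cp Habs) as [HQ CQ].
      change (step_dens g th0 (S m)) with (fun t' => Integral (fun t => p t * K t t')).
      split; [exact CQ|]; split.
      + intros t'; refine (improper_int_nonneg _ _ _ (HQ t')); intros t.
        apply Rmult_le_pos; [auto|apply HB].
      + assert (H : improper_int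
            (fun t' => Integral (fun t => p t * K t t') * (fun _ => 1) t') 1).
        { apply (kernel_image_weight K Bd (fun _ => 1) (fun _ => 1) p 1); auto;
            try (cont_tac; fail); try (intros; lra).
          - intros t; refine (improper_int_ext _ _ _ _ (H1 t)); intros; simpl; ring.
          - refine (improper_int_ext _ _ _ _ Hp1); intros; simpl; ring. }
        refine (improper_int_ext _ _ _ _ H); intros; simpl; ring. }
  set (W := fun t => 1 + beta * V t).
  assert (HW : forall t, 1 <= W t) by (intros t; specialize (HV t); unfold W; nra).
  assert (CW : continuity W) by (unfold W; cont_tac).
  set (h := fun th0 m t => step_dens g th0 m t - pi t).
  assert (Ch : forall th0 m, continuity (h th0 m)).
  { intros th0 m; destruct (Hp th0 m) as [Cp _]; unfold h; cont_tac. }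
  assert (H0 : forall th0 m, improper_int (h th0 m) 0).
  { intros th0 m; destruct (Hp th0 m) as [_ [_ Hp1]]; replace 0 with (1 - 1) by ring.
    apply improper_int_minus; assumption. }
  assert (Hc0 : forall th0, exists c0, improper_int (fun t => W t * Rabs (h th0 O t)) c0).
  { intros th0.
    destruct (improper_int_dominated (fun t => W t * Rabs (h th0 O t))
      (fun t => (K th0 t + beta * (K th0 t * V t)) + (pi t + beta * (pi t * V t)))
      ((1 + beta * PV th0) + (1 + beta * cV))) as [c0 [Hc0 _]].
    - specialize (Ch th0 O); set (h0 := h th0 O) in *; cont_tac.
    - intros t; specialize (HW t); pose proof (Rabs_pos (h th0 O t)).
      rewrite Rabs_pos_eq by (apply Rmult_le_pos; lra).
      replace (K th0 t + beta * (K th0 t * V t) + (pi t + beta * (pi t * V t)))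
        with (W t * (K th0 t + pi t)) by (unfold W; ring).
      apply Rmult_le_compat_l; [lra|].
      unfold h; cbn [step_dens]; fold K.
      specialize (Hpi t); destruct (HB th0 t) as [? _]; apply Rabs_le; lra.
    - repeat apply improper_int_plus; try apply improper_int_scal; auto.
    - exists c0; exact Hc0. }
  destruct (choice_function _ _ _ Hc0) as [c0 Hc0'].
  assert (Hcm : forall th0 m, exists c, improper_int (fun t => W t * Rabs (h th0 m t)) c /\
            c <= c0 th0 * alpha ^ m).
  { intros th0; induction m as [|m [c [Hc Hcle]]].
    - exists (c0 th0); split; [apply Hc0'|simpl; lra].
    - destruct (Hcontr (h th0 m) c (Ch th0 m) (H0 th0 m) Hc) as [c' [Hc' Hle]].
      exists c'; split.
      + refine (improper_int_ext _ _ _ _ Hc'); intros t'; unfold W; f_equal; f_equal.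
        destruct (Hp th0 m) as [Cp [Hpp Hp1]].
        set (p := step_dens g th0 m) in *.
        assert (Habs : improper_int (fun t => Rabs (p t)) 1).
        { refine (improper_int_ext _ _ _ _ Hp1); intros t; rewrite Rabs_pos_eq; auto. }
        destruct (kernel_image K Bd p 1 HK HB Cp Habs) as [HQ _].
        apply Integral_eq.
        refine (improper_int_ext _ _ _ _ (improper_int_minus _ _ _ _ (HQ t') (Hinv t'))).
        intros t; unfold h; fold p; simpl; ring.
      + simpl; nra. }
  (* The 1 covers [n = 0], where the distance is 1 by definition. Division by [alpha] makes up for
     the index shift: time [n = m + 1] carries only the factor [alpha ^ m]. *)
  exists alpha, (fun th0 => 1 + c0 th0 / alpha); split; [apply Halpha|].
  assert (Hc0p : forall th0, 0 <= c0 th0).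
  { intros th0; refine (improper_int_nonneg _ _ _ (Hc0' th0)); intros t.
    apply Rmult_le_pos; [specialize (HW t); lra|apply Rabs_pos]. }
  assert (Hc0a : forall th0, 0 <= c0 th0 / alpha).
  { intros th0; apply Rmult_le_pos; [apply Hc0p|left; apply Rinv_0_lt_compat; lra]. }
  intros th0 [|m].
  - simpl; specialize (Hc0a th0); lra.
  - destruct (Hcm th0 m) as [c [Hc Hcle]].
    assert (Chm : continuity (fun t => Rabs (h th0 m t))).
    { specialize (Ch th0 m); set (hm := h th0 m) in *; cont_tac. }
    destruct (improper_int_dominated (fun t => Rabs (h th0 m t))
      (fun t => W t * Rabs (h th0 m t)) c Chm) as [I [HI HIc]]; [|exact Hc|].
    { intros t; rewrite Rabs_Rabsolu; pose proof (Rabs_pos (h th0 m t)).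
      specialize (HW t); nra. }
    change (/ 2 * Integral (fun t => Rabs (h th0 m t)) <=
            (1 + c0 th0 / alpha) * alpha ^ S m).
    rewrite (Integral_eq _ I HI); apply Rabs_le_between in HIc.
    assert (0 < alpha ^ m) by (apply pow_lt; lra).
    assert (E : c0 th0 / alpha * alpha ^ S m = c0 th0 * alpha ^ m)
      by (simpl; field; lra).
    assert (0 < alpha ^ S m) by (apply pow_lt; lra).
    specialize (Hc0p th0).
    assert (0 <= c0 th0 * alpha ^ m) by (apply Rmult_le_pos; lra).
    lra.
Qed.

(** * The Gibbs sampler *)

Lemma good_density_bounds (f : R -> R) :
  good_density f ->
  continuity f /\ (exists B, 0 < B /\ forall z, 0 < f z <= B) /\
  (forall z, f (- z) = f z) /\ improper_int f 1.
Proof.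
  intros [Hc [[B HB] [Hp [Hs Hi]]]]; split; [exact Hc|]; split; [|auto].
  exists B; split; [specialize (Hp 0); specialize (HB 0); lra|auto].
Qed.

(** The convolution of [f1] and [f2] at [y - t], that is the likelihood of [t]; under the flat prior
    it is the marginal posterior up to normalisation. *)
Definition marg (f1 f2 : R -> R) (y t : R) : R := Integral (fun u => P0 f1 f2 y u t).

(* [/ marg t] times this is the transition density of the chain of [P0]. *)
Definition joint (f1 f2 : R -> R) (y t t' : R) : R :=
  Integral (fun u => P0 f1 f2 y u t * f2 (u - t')).

Lemma marg_spec (f1 f2 : R -> R) (y : R) :
  good_density f1 -> good_density f2 ->
  (forall t, improper_int (fun u => P0 f1 f2 y u t) (marg f1 f2 y t)) /\
  continuity (marg f1 f2 y) /\ (forall t, 0 < marg f1 f2 y t) /\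
  (exists B, forall t, marg f1 f2 y t <= B).
Proof.
  intros H1 H2.
  destruct (good_density_bounds f1 H1) as [C1 [[B1 [PB1 HB1]] [S1 I1]]].
  destruct (good_density_bounds f2 H2) as [C2 [[B2 [PB2 HB2]] [S2 I2]]].
  pose proof (improper_int_scal B2 _ _ (proj2 (improper_int_reflect f1 y 1) I1)) as HJ.
  assert (Hdom : forall t u, Rabs (P0 f1 f2 y u t) <= B2 * f1 (y - u)).
  { intros t u; unfold P0; specialize (HB1 (y - u)); specialize (HB2 (u - t)).
    rewrite Rabs_pos_eq by (apply Rmult_le_pos; lra); nra. }
  assert (CP : cont2 (fun t u => P0 f1 f2 y u t)) by (unfold P0; cont_tac).
  assert (CPt : forall t, continuity (fun u => P0 f1 f2 y u t)).
  { intros t; unfold P0; cont_tac. }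
  assert (HI : forall t, improper_int (fun u => P0 f1 f2 y u t) (marg f1 f2 y t) /\
                 marg f1 f2 y t <= B2 * 1).
  { intros t; destruct (improper_int_dominated _ _ _ (CPt t) (Hdom t) HJ) as [I [HI HIB]].
    unfold marg; rewrite (Integral_eq _ _ HI); split; [exact HI|].
    apply Rabs_le_between in HIB; lra. }
  split; [apply HI|]; split; [|split].
  - apply (improper_int_param_cont (fun t u => P0 f1 f2 y u t)); [exact CP|apply HI|].
    intros L; exists (fun u => B2 * f1 (y - u)), (B2 * 1); auto.
  - intros t; apply (improper_int_pos (fun u => P0 f1 f2 y u t)); [apply CPt| |apply HI].
    intros u; apply Rmult_lt_0_compat; [apply HB1|apply HB2].
  - exists (B2 * 1); intros t; apply HI.
Qed.

(** Detailed balance: [joint] is [marg t] times the transition density, so symmetry makes the chain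
    reversible and [marg] invariant. *)
Lemma joint_sym (f1 f2 : R -> R) (y t t' : R) : joint f1 f2 y t t' = joint f1 f2 y t' t.
Proof.
  unfold joint, P0; f_equal; apply functional_extensionality; intros u; ring.
Qed.

(** Parameter continuity is available in one variable only. Joint continuity comes from the modulus
    [om s t], which bounds the variation in the second argument uniformly in the first, because the
    factor [f2 (u - r)] is at most [B2]; symmetry then handles the other argument. The bound by a
    multiple of [marg] makes the quotient a bounded kernel. *)
Lemma joint_spec (f1 f2 : R -> R) (y : R) :
  good_density f1 -> good_density f2 ->
  (forall t t', improper_int (fun u => P0 f1 f2 y u t * f2 (u - t')) (joint f1 f2 y t t')) /\
  (exists B, forall t t', 0 <= joint f1 f2 y t t' <= B * marg f1 f2 y t) /\
  cont2 (joint f1 f2 y).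
Proof.
  intros H1 H2.
  destruct (marg_spec f1 f2 y H1 H2) as [HM [CM [PM _]]].
  destruct (good_density_bounds f1 H1) as [C1 [[B1 [PB1 HB1]] [S1 I1]]].
  destruct (good_density_bounds f2 H2) as [C2 [[B2 [PB2 HB2]] [S2 I2]]].
  set (J := joint f1 f2 y).
  assert (HP : forall u t, 0 <= P0 f1 f2 y u t).
  { intros u t; apply Rmult_le_pos; left; [apply HB1|apply HB2]. }
  assert (HJ : forall t t', improper_int (fun u => P0 f1 f2 y u t * f2 (u - t')) (J t t') /\
                 0 <= J t t' <= B2 * marg f1 f2 y t).
  { intros t t'.
    destruct (improper_int_dominated (fun u => P0 f1 f2 y u t * f2 (u - t'))
      (fun u => B2 * P0 f1 f2 y u t) (B2 * marg f1 f2 y t)) as [I [HI HIB]].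
    - unfold P0; cont_tac.
    - intros u; specialize (HP u t); specialize (HB2 (u - t')).
      rewrite Rabs_pos_eq by (apply Rmult_le_pos; lra); nra.
    - apply improper_int_scal, HM.
    - unfold J, joint; rewrite (Integral_eq _ _ HI); split; [exact HI|].
      split; [|apply Rabs_le_between in HIB; lra].
      refine (improper_int_nonneg _ _ _ HI); intros u.
      apply Rmult_le_pos; [apply HP|left; apply HB2]. }
  split; [apply HJ|]; split; [exists B2; apply HJ|].
  pose proof (proj2 (improper_int_reflect f1 y 1) I1) as I1y.
  set (om := fun s t => Integral (fun u => f1 (y - u) * Rabs (f2 (u - t) - f2 (u - s)))).
  assert (Hdom : forall s t u, Rabs (f1 (y - u) * Rabs (f2 (u - t) - f2 (u - s)))
                   <= B2 * f1 (y - u)).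
  { intros s t u; specialize (HB1 (y - u)); pose proof (HB2 (u - t)); specialize (HB2 (u - s)).
    assert (Rabs (f2 (u - t) - f2 (u - s)) <= B2) by (apply Rabs_le; lra).
    pose proof (Rabs_pos (f2 (u - t) - f2 (u - s))).
    rewrite Rabs_pos_eq by (apply Rmult_le_pos; lra); nra. }
  assert (Hom : forall s t, improper_int
            (fun u => f1 (y - u) * Rabs (f2 (u - t) - f2 (u - s))) (om s t)).
  { intros s t; destruct (improper_int_dominated
      (fun u => f1 (y - u) * Rabs (f2 (u - t) - f2 (u - s))) (fun u => B2 * f1 (y - u))
      (B2 * 1)) as [I [HI _]]; [cont_tac|apply Hdom|apply improper_int_scal, I1y|].
    unfold om; rewrite (Integral_eq _ _ HI); exact HI. }
  assert (Com : forall s, continuity (om s)).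
  { intros s; apply (improper_int_param_cont
      (fun t u => f1 (y - u) * Rabs (f2 (u - t) - f2 (u - s)))); [cont_tac|apply Hom|].
    intros L; exists (fun u => B2 * f1 (y - u)), (B2 * 1).
    split; [apply improper_int_scal, I1y|intros t u _; apply Hdom]. }
  assert (Hom0 : forall s, om s s = 0).
  { intros s; apply Integral_eq.
    pose proof (improper_int_scal 0 _ _ I1y) as H; rewrite Rmult_0_l in H.
    refine (improper_int_ext _ _ _ _ H); intros u.
    simpl; rewrite Rminus_diag, Rabs_R0; ring. }
  assert (HJom : forall r s t, Rabs (J r t - J r s) <= B2 * om s t).
  { intros r s t.
    pose proof (improper_int_minus _ _ _ _ (proj1 (HJ r t)) (proj1 (HJ r s))) as HD.
    simpl in HD.
    destruct (improper_int_dominated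
      (fun u => P0 f1 f2 y u r * f2 (u - t) - P0 f1 f2 y u r * f2 (u - s))
      (fun u => B2 * (f1 (y - u) * Rabs (f2 (u - t) - f2 (u - s)))) (B2 * om s t))
      as [I [HI HIB]].
    - unfold P0; cont_tac.
    - intros u; rewrite <- Rmult_minus_distr_l, Rabs_mult, (Rabs_pos_eq (P0 _ _ _ _ _)) by auto.
      unfold P0; specialize (HB1 (y - u)); specialize (HB2 (u - r)).
      pose proof (Rabs_pos (f2 (u - t) - f2 (u - s))).
      rewrite <- Rmult_assoc; apply Rmult_le_compat_r; nra.
    - apply improper_int_scal, Hom.
    - rewrite (improper_int_unique _ _ _ HD HI); exact HIB. }
  intros t0 s0 eps; pose proof (cond_pos eps) as Heps.
  assert (He : 0 < eps / (2 * B2)) by (apply Rdiv_lt_0_compat; lra).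
  assert (Hloc : forall s, exists d, 0 < d /\ forall t, Rabs (t - s) < d ->
            B2 * om s t < eps / 2).
  { intros s; destruct (Com s s _ He) as [d [Hd H]]; exists d; split; [exact Hd|].
    intros t Ht.
    assert (Hlt : om s t < eps / (2 * B2)).
    { destruct (Req_dec t s) as [->|Hn]; [rewrite Hom0; exact He|].
      assert (Hdist : dist R_met (om s t) (om s s) < eps / (2 * B2)).
      { apply H; split; [split; [exact Logic.I|auto]|exact Ht]. }
      simpl in Hdist; unfold R_dist in Hdist; rewrite Hom0 in Hdist.
      apply Rabs_def2 in Hdist; lra. }
    apply (Rmult_lt_compat_l B2) in Hlt; [|exact PB2].
    replace (B2 * (eps / (2 * B2))) with (eps / 2) in Hlt by (field; lra); exact Hlt. }
  destruct (Hloc t0) as [d1 [Hd1 HJ1]]; destruct (Hloc s0) as [d2 [Hd2 HJ2]].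
  exists (mkposreal (Rmin d1 d2) (Rmin_pos _ _ Hd1 Hd2)); simpl; intros t s Ht Hs.
  pose proof (Rmin_l d1 d2); pose proof (Rmin_r d1 d2).
  specialize (HJ1 t ltac:(lra)); specialize (HJ2 s ltac:(lra)).
  pose proof (HJom t s0 s) as E1; pose proof (HJom s0 t0 t) as E2.
  unfold J in E2; rewrite (joint_sym f1 f2 y s0 t), (joint_sym f1 f2 y s0 t0) in E2; fold J in E2.
  apply Rabs_le_between in E1; apply Rabs_le_between in E2; apply Rabs_def1; lra.
Qed.

(** Given [X], the observation carries no further information on Theta: the factor [f1 (y - u)]
    cancels, and the flat prior leaves the law of [u - Z2]. *)
Lemma condT_P0 (f1 f2 : R -> R) (y u t : R) :
  good_density f1 -> good_density f2 -> condT (P0 f1 f2 y) u t = f2 (u - t).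
Proof.
  intros H1 H2; unfold condT.
  destruct (good_density_bounds f1 H1) as [C1 [[B1 [PB1 HB1]] [S1 I1]]].
  destruct (good_density_bounds f2 H2) as [C2 [[B2 [PB2 HB2]] [S2 I2]]].
  rewrite (Integral_eq _ (f1 (y - u) * 1)).
  - unfold P0; specialize (HB1 (y - u)); field; lra.
  - apply (improper_int_scal (f1 (y - u)) (fun t => f2 (u - t))).
    apply improper_int_reflect, I2.
Qed.

Lemma kern_P0 (f1 f2 : R -> R) (y t t' : R) :
  good_density f1 -> good_density f2 ->
  kern (P0 f1 f2 y) t t' = joint f1 f2 y t t' / marg f1 f2 y t.
Proof.
  intros H1 H2; destruct (joint_spec f1 f2 y H1 H2) as [HJ _].
  apply Integral_eq; unfold Rdiv; rewrite Rmult_comm.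
  refine (improper_int_ext _ _ _ _ (improper_int_scal _ _ _ (HJ t t'))); intros u.
  rewrite condT_P0 by assumption; unfold condU; fold (marg f1 f2 y t).
  simpl; unfold Rdiv; ring.
Qed.

(** One Gibbs step applied to a function in two halves: [G] is the mean of [W] after the Theta
    update, which is then averaged over [u]. *)
Lemma joint_weight (f1 f2 : R -> R) (y : R) (W G : R -> R) (t I : R) :
  good_density f1 -> good_density f2 ->
  continuity W -> (forall s, 0 <= W s) -> continuity G ->
  (forall u, improper_int (fun s => f2 (u - s) * W s) (G u)) ->
  improper_int (fun u => P0 f1 f2 y u t * G u) I ->
  improper_int (fun s => joint f1 f2 y t s * W s) I.
Proof.
  intros H1 H2 CW HW CG HG HI.
  destruct (joint_spec f1 f2 y H1 H2) as [HJ [_ CJ]].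
  destruct (good_density_bounds f1 H1) as [C1 [[B1 [PB1 HB1]] [S1 I1]]].
  destruct (good_density_bounds f2 H2) as [C2 [[B2 [PB2 HB2]] [S2 I2]]].
  apply (Tonelli (fun u s => P0 f1 f2 y u t * f2 (u - s) * W s)
    (fun u => P0 f1 f2 y u t * G u)); auto.
  - unfold P0; cont_tac.
  - intros u s; apply Rmult_le_pos; [|auto].
    unfold P0; repeat apply Rmult_le_pos; left; solve [apply HB1|apply HB2].
  - unfold P0; cont_tac.
  - cont_tac.
  - intros u; refine (improper_int_ext _ _ _ _ (improper_int_scal (P0 f1 f2 y u t) _ _ (HG u))).
    intros; simpl; ring.
  - intros s; rewrite Rmult_comm.
    refine (improper_int_ext _ _ _ _ (improper_int_scal (W s) _ _ (HJ t s))).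
    intros; simpl; ring.
Qed.

Lemma joint_mass (f1 f2 : R -> R) (y t : R) :
  good_density f1 -> good_density f2 ->
  improper_int (joint f1 f2 y t) (marg f1 f2 y t).
Proof.
  intros H1 H2; destruct (marg_spec f1 f2 y H1 H2) as [HM _].
  destruct (good_density_bounds f2 H2) as [C2 [_ [_ I2]]].
  refine (improper_int_ext _ _ _ _
    (joint_weight f1 f2 y (fun _ => 1) (fun _ => 1) t _ H1 H2 _ _ _ _ _)).
  - intros; simpl; ring.
  - cont_tac.
  - intros; lra.
  - cont_tac.
  - intros u; refine (improper_int_ext _ _ _ _ (proj2 (improper_int_reflect f2 u 1) I2)).
    intros; simpl; ring.
  - refine (improper_int_ext _ _ _ _ (HM t)); intros; simpl; ring.
Qed.

(** Integrating over [t] first leaves [f1 (y - u)], of mass 1; so [marg] is already the normalised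
    posterior. *)
Lemma marg_mass (f1 f2 : R -> R) (y : R) :
  good_density f1 -> good_density f2 -> improper_int (marg f1 f2 y) 1.
Proof.
  intros H1 H2; destruct (marg_spec f1 f2 y H1 H2) as [HM [CM _]].
  destruct (good_density_bounds f1 H1) as [C1 [[B1 [PB1 HB1]] [S1 I1]]].
  destruct (good_density_bounds f2 H2) as [C2 [[B2 [PB2 HB2]] [S2 I2]]].
  apply (Tonelli (P0 f1 f2 y) (fun u => f1 (y - u))); auto.
  - change (cont2 (fun u t => P0 f1 f2 y u t)); unfold P0; cont_tac.
  - intros u t; unfold P0; apply Rmult_le_pos; left; [apply HB1|apply HB2].
  - cont_tac.
  - intros u; rewrite <- (Rmult_1_r (f1 (y - u))).
    apply (improper_int_scal (f1 (y - u)) (fun t => f2 (u - t))).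
    apply improper_int_reflect, I2.
  - apply improper_int_reflect, I1.
Qed.

Lemma post_P0 (f1 f2 : R -> R) (y t : R) :
  good_density f1 -> good_density f2 -> post (P0 f1 f2 y) t = marg f1 f2 y t.
Proof.
  intros H1 H2; unfold post.
  change (marg f1 f2 y t / Integral (marg f1 f2 y) = marg f1 f2 y t).
  rewrite (Integral_eq _ _ (marg_mass f1 f2 y H1 H2)); field.
Qed.

Lemma cont_pos_lower_bound (f : R -> R) (r : R) :
  continuity f -> (forall x, 0 < f x) ->
  exists e, 0 < e /\ forall x, Rabs x <= r -> e <= f x.
Proof.
  intros Hf Hp; destruct (Rle_lt_dec 0 r) as [Hr|Hr].
  - destruct (continuity_ab_min f (-r) r ltac:(lra) ltac:(auto)) as [x [Hx _]].
    exists (f x); split; [apply Hp|]; intros z Hz; apply Hx.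
    apply Rabs_le_between in Hz; lra.
  - exists 1; split; [lra|]; intros x Hx; pose proof (Rabs_pos x); lra.
Qed.

Lemma kern_P0_markov (f1 f2 : R -> R) (y : R) :
  good_density f1 -> good_density f2 -> markov_kernel (kern (P0 f1 f2 y)).
Proof.
  intros H1 H2.
  assert (E : kern (P0 f1 f2 y) = fun t t' => joint f1 f2 y t t' / marg f1 f2 y t).
  { apply functional_extensionality; intros t; apply functional_extensionality; intros t'.
    apply kern_P0; assumption. }
  destruct (marg_spec f1 f2 y H1 H2) as [HM [CM [PM [BM HBM]]]].
  destruct (joint_spec f1 f2 y H1 H2) as [HJ [[BJ HBJ] CJ]].
  destruct (good_density_bounds f1 H1) as [C1 [[B1 [PB1 HB1]] [S1 I1]]].
  destruct (good_density_bounds f2 H2) as [C2 [[B2 [PB2 HB2]] [S2 I2]]].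
  set (m := marg f1 f2 y) in *; set (J := joint f1 f2 y) in *.
  assert (PMi : forall t, 0 < / m t) by (intros t; apply Rinv_0_lt_compat, PM).
  rewrite E; split; [|split; [|split]].
  - cont_tac; intros t t'; apply Rgt_not_eq, PM.
  - exists BJ; intros t t'; specialize (HBJ t t'); specialize (PMi t); specialize (PM t); split.
    + apply Rmult_le_pos; lra.
    + apply (Rmult_le_reg_r (m t)); [exact PM|].
      unfold Rdiv; rewrite Rmult_assoc, Rinv_l by lra; lra.
  - intros t; specialize (PM t).
    pose proof (improper_int_scal (/ m t) _ _ (joint_mass f1 f2 y t H1 H2)) as H.
    fold m J in H; rewrite Rinv_l in H by lra.
    refine (improper_int_ext _ _ _ _ H); intros t'; simpl; unfold Rdiv; ring.
  - intros rho.
    (* The lower bound on the kernel uses only [u] in [[0, 1]]. There [|y - u| <= |y| + 1], while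
       [|u - t|] and [|u - t'|] are at most [|rho| + 2]. *)
    destruct (cont_pos_lower_bound f1 (Rabs y + 1) C1 ltac:(intros; apply HB1)) as [e1 [Pe1 He1]].
    destruct (cont_pos_lower_bound f2 (Rabs rho + 2) C2 ltac:(intros; apply HB2)) as [e2 [Pe2 He2]].
    assert (PBM : 0 < BM) by (specialize (HBM 0); specialize (PM 0); lra).
    assert (Pe : 0 < e1 * e2 * e2) by (repeat apply Rmult_lt_0_compat; assumption).
    exists (e1 * e2 * e2 / BM); split; [apply Rdiv_lt_0_compat; assumption|].
    intros t t' Ht Ht'.
    assert (HJl : e1 * e2 * e2 <= J t t').
    { apply Rle_trans with (RInt (fun u => P0 f1 f2 y u t * f2 (u - t')) 0 1).
      - apply Rle_trans with (RInt (fun _ => e1 * e2 * e2) 0 1).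
        + right; symmetry; transitivity ((1 - 0) * (e1 * e2 * e2));
            [exact (RInt_const 0 1 _)|ring].
        + apply RInt_le_cont; [lra|cont_tac|unfold P0; cont_tac|].
          intros u Hu; unfold P0.
          assert (e1 <= f1 (y - u)) by (apply He1; rabs).
          assert (e2 <= f2 (u - t)) by (apply He2; rabs).
          assert (e2 <= f2 (u - t')) by (apply He2; rabs).
          repeat apply Rmult_le_compat; try lra; apply Rmult_le_pos; lra.
      - apply RInt_le_improper; [|apply HJ|lra].
        intros u; unfold P0; repeat apply Rmult_le_pos; left; solve [apply HB1|apply HB2]. }
    unfold Rdiv; apply Rmult_le_compat; [lra| |exact HJl|].
    + left; apply Rinv_0_lt_compat, PBM.
    + apply Rinv_le_contravar; [apply PM|apply HBM].
Qed.

Lemma post_P0_stationary (f1 f2 : R -> R) (y t' : R) :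
  good_density f1 -> good_density f2 ->
  improper_int (fun t => post (P0 f1 f2 y) t * kern (P0 f1 f2 y) t t') (post (P0 f1 f2 y) t').
Proof.
  intros H1 H2; destruct (marg_spec f1 f2 y H1 H2) as [_ [_ [PM _]]].
  rewrite post_P0 by assumption.
  refine (improper_int_ext _ _ _ _ (joint_mass f1 f2 y t' H1 H2)); intros t.
  rewrite post_P0, kern_P0, joint_sym by assumption; specialize (PM t); field; lra.
Qed.

(** * Exponential moments and drift *)

(** Multiplying [1 - x <= exp (- x)] by [exp x] gives [exp x - 1 <= x * exp x], hence
    [exp x - 1 - x <= x * (exp x - 1)]; the same inequality for [x >= 0], or [x <= exp x - 1] for
    [x < 0], bounds the right side. *)
Lemma exp_le_quadratic (x : R) : exp x <= 1 + x + x * x * exp (Rabs x).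
Proof.
  assert (H1 : exp x - 1 <= x * exp x).
  { pose proof (exp_ineq1_le (- x)); pose proof (exp_pos x).
    assert (exp (- x) * exp x = 1) by (rewrite <- exp_plus, <- exp_0; f_equal; ring).
    nra. }
  pose proof (exp_ineq1_le x); pose proof (exp_ineq1_le (Rabs x)).
  destruct (Rle_lt_dec 0 x) as [Hx|Hx].
  - rewrite (Rabs_pos_eq x) in * by exact Hx; nra.
  - pose proof (Rabs_pos x).
    assert (x * (exp x - 1) <= x * x) by nra.
    assert (exp x - 1 - x <= x * x).
    { apply Rle_trans with (x * (exp x - 1)); [|assumption].
      nra. }
    assert (0 <= x * x) by nra. nra.
Qed.

(** Half of the rate [c] is spent on the square: with [v = c / 2 * |x|], the bound
    [(1 + v / 2)^2 <= exp v] yields [v^2 <= 4 * exp v], and [x^2 = 4 / c^2 * v^2] gives the constant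
    16. *)
Lemma sqr_le_exp (c x : R) : 0 < c -> x * x * exp (c / 2 * Rabs x) <= 16 / (c * c) * exp (c * Rabs x).
Proof.
  intros Hc; set (v := c / 2 * Rabs x).
  assert (Hv : 0 <= v) by (apply Rmult_le_pos; [lra|apply Rabs_pos]).
  assert (E : exp (c * Rabs x) = exp v * exp v) by (rewrite <- exp_plus; f_equal; unfold v; field).
  assert (Ex : x * x = 4 / (c * c) * (v * v)).
  { unfold v; replace (x * x) with (Rabs x * Rabs x); [field; lra|].
    rewrite <- Rabs_mult, Rabs_pos_eq; nra. }
  assert (Hq : v * v <= 4 * exp v).
  { assert (exp v = exp (v / 2) * exp (v / 2)) by (rewrite <- exp_plus; f_equal; field).
    pose proof (exp_ineq1_le (v / 2)).
    assert ((1 + v / 2) * (1 + v / 2) <= exp (v / 2) * exp (v / 2))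
      by (apply Rmult_le_compat; lra).
    nra. }
  rewrite E, Ex; pose proof (exp_pos v).
  assert (0 < / (c * c)) by (apply Rinv_0_lt_compat; nra).
  assert (H8 : v * v * exp v <= 4 * exp v * exp v) by (apply Rmult_le_compat_r; lra).
  apply (Rmult_le_compat_l (4 * / (c * c))) in H8; [|lra].
  unfold Rdiv; lra.
Qed.

Lemma exp_le_compat (x z : R) : x <= z -> exp x <= exp z.
Proof. intros [H| ->]; [left; apply exp_increasing, H|right; reflexivity]. Qed.

Lemma exp_le_exp_abs (lam c z : R) : Rabs lam <= c -> exp (lam * z) <= exp (c * Rabs z).
Proof.
  intros H; apply exp_le_compat, Rle_trans with (Rabs (lam * z)); [apply Rle_abs|].
  rewrite Rabs_mult; apply Rmult_le_compat_r; [apply Rabs_pos|exact H].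
Qed.

(** Second-order Taylor bound whose remainder depends on [q] only through one exponential moment,
    hence uniform over any family with a common bound on it. The condition [|lam| <= c / 2] leaves
    room to absorb the square. *)
Lemma exp_moment_expansion (q : R -> R) (c I e lam : R) :
  continuity q -> (forall z, 0 <= q z) -> improper_int q 1 -> 0 < c ->
  improper_int (fun z => exp (c * Rabs z) * q z) I ->
  improper_int (fun z => z * q z) e -> Rabs lam <= c / 2 ->
  exists L, improper_int (fun z => exp (lam * z) * q z) L /\ 0 <= L <= I /\
    L <= 1 + lam * e + lam * lam * (16 / (c * c) * I).
Proof.
  intros Cq Hq H1 Hc HI He Hlam.
  destruct (improper_int_dominated (fun z => exp (lam * z) * q z)
    (fun z => exp (c * Rabs z) * q z) I) as [L [HL HLI]]; [cont_tac| |exact HI|].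
  { intros z; pose proof (exp_pos (lam * z)); specialize (Hq z).
    rewrite Rabs_pos_eq by (apply Rmult_le_pos; lra).
    apply Rmult_le_compat_r; [exact Hq|apply exp_le_exp_abs; lra]. }
  assert (HL0 : 0 <= L).
  { refine (improper_int_nonneg _ _ _ HL); intros z.
    apply Rmult_le_pos; [left; apply exp_pos|apply Hq]. }
  exists L; split; [exact HL|]; split; [apply Rabs_le_between in HLI; lra|].
  refine (improper_int_le _ _ _ _ _ HL (improper_int_plus _ _ _ _
    (improper_int_plus _ _ _ _ H1 (improper_int_scal lam _ _ He))
    (improper_int_scal (lam * lam) _ _ (improper_int_scal (16 / (c * c)) _ _ HI)))).
  intros z; simpl.
  replace (q z + lam * (z * q z) + lam * lam * (16 / (c * c) * (exp (c * Rabs z) * q z)))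
    with ((1 + lam * z + lam * lam * (16 / (c * c) * exp (c * Rabs z))) * q z) by ring.
  apply Rmult_le_compat_r; [apply Hq|].
  eapply Rle_trans; [apply exp_le_quadratic|].
  apply Rplus_le_compat_l.
  replace (lam * z * (lam * z) * exp (Rabs (lam * z)))
    with (lam * lam * (z * z * exp (Rabs (lam * z)))) by ring.
  apply Rmult_le_compat_l; [nra|].
  eapply Rle_trans; [|apply sqr_le_exp, Hc].
  apply Rmult_le_compat_l; [nra|].
  apply exp_le_compat; rewrite Rabs_mult.
  apply Rmult_le_compat_r; [apply Rabs_pos|exact Hlam].
Qed.

Lemma first_moment_exists (q : R -> R) (c I : R) :
  continuity q -> (forall z, 0 <= q z) -> 0 < c ->
  improper_int (fun z => exp (c * Rabs z) * q z) I ->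
  exists e, improper_int (fun z => z * q z) e.
Proof.
  intros Cq Hq Hc HI.
  destruct (improper_int_dominated (fun z => z * q z)
    (fun z => / c * (exp (c * Rabs z) * q z)) (/ c * I)) as [e [He _]];
    [cont_tac| |apply improper_int_scal, HI|exists e; exact He].
  intros z; rewrite Rabs_mult, (Rabs_pos_eq (q z)), <- Rmult_assoc by auto.
  apply Rmult_le_compat_r; [auto|].
  apply (Rmult_le_reg_l c); [exact Hc|].
  rewrite <- Rmult_assoc, Rinv_r, Rmult_1_l by lra.
  pose proof (exp_ineq1_le (c * Rabs z)); lra.
Qed.

Lemma cosh_le_exp (x : R) : cosh x <= exp (Rabs x).
Proof.
  unfold cosh.
  assert (exp x <= exp (Rabs x)) by (apply exp_le_compat, Rle_abs).
  assert (exp (- x) <= exp (Rabs x)) by (apply exp_le_compat; rabs).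
  lra.
Qed.

Lemma exp_le_cosh (x : R) : exp (Rabs x) <= 2 * cosh x.
Proof.
  unfold cosh; pose proof (exp_pos x); pose proof (exp_pos (- x)).
  destruct (Rcase_abs x) as [H1|H1]; [rewrite Rabs_left|rewrite Rabs_right]; lra.
Qed.

Lemma cosh_ge_1 (x : R) : 1 <= cosh x.
Proof.
  unfold cosh; pose proof (exp_ineq1_le x); pose proof (exp_ineq1_le (- x)); lra.
Qed.

(** The integrand jumps at [x] and [- x], so the lemmas on continuous functions do not apply; it is
    integrated over three pieces, on each of which it agrees inside with a continuous function. *)
Lemma improper_int_tail (q : R -> R) (x : R) :
  continuity q -> improper_int q 1 -> 0 <= x ->
  improper_int (fun u => if Rle_dec (Rabs u) x then 0 else q u) (1 - RInt q (- x) x).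
Proof.
  intros Cq Hq Hx; set (f := fun u => if Rle_dec (Rabs u) x then 0 else q u).
  assert (Eq : forall a b, ex_RInt q a b) by (intros; apply cont_ex_RInt, Cq).
  assert (Em : is_RInt f (-x) x 0).
  { apply (is_RInt_ext (fun _ => 0)).
    - intros u; rewrite Rmin_left, Rmax_right by lra; intros Hu; unfold f.
      destruct Rle_dec as [_|Hn]; [reflexivity|].
      exfalso; apply Hn, Rabs_le; lra.
    - pose proof (is_RInt_const (V := R_NormedModule) (-x) x 0) as H.
      change (is_RInt (fun _ : R => 0) (-x) x ((x - - x) * 0)) in H.
      rewrite Rmult_0_r in H; exact H. }
  assert (Er : forall b, x <= b -> is_RInt f x b (RInt q x b)).
  { intros b Hb; apply (is_RInt_ext q); [|apply RInt_correct_R, Eq].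
    intros u; rewrite Rmin_left, Rmax_right by lra; intros Hu; unfold f.
    destruct Rle_dec as [H|_]; [exfalso; rabs|reflexivity]. }
  assert (El : forall a, a <= - x -> is_RInt f a (- x) (RInt q a (- x))).
  { intros a Ha; apply (is_RInt_ext q); [|apply RInt_correct_R, Eq].
    intros u; rewrite Rmin_left, Rmax_right by lra; intros Hu; unfold f.
    destruct Rle_dec as [H|_]; [exfalso; rabs|reflexivity]. }
  assert (Ew : forall a b, a <= - x -> x <= b -> is_RInt f a b (RInt q a (-x) + RInt q x b)).
  { intros a b Ha Hb.
    replace (RInt q a (-x) + RInt q x b) with (plus (RInt q a (-x)) (plus 0 (RInt q x b)))
      by (unfold plus; simpl; ring).
    apply (is_RInt_Chasles f a (-x) b); [apply El, Ha|].
    apply (is_RInt_Chasles f (-x) x b); [exact Em|apply Er, Hb]. }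
  assert (Ele : forall a b, a <= b -> ex_RInt f a b).
  { intros a b Hab.
    pose proof (Rmin_l a (-x)); pose proof (Rmin_r a (-x)).
    pose proof (Rmax_l b x); pose proof (Rmax_r b x).
    apply (ex_RInt_Chasles_1 (V := R_CompleteNormedModule) f a b (Rmax b x)); [lra|].
    apply (ex_RInt_Chasles_2 (V := R_CompleteNormedModule) f (Rmin a (-x)) a (Rmax b x)); [lra|].
    eexists; apply Ew; lra. }
  apply improper_intE; split.
  - intros a b; destruct (Rle_lt_dec a b); [auto|apply ex_RInt_swap, Ele; lra].
  - intros eps Heps; destruct (improper_int_near _ _ eps Hq Heps) as [M [HM HMq]].
    exists (Rmax M x); intros a b Ha Hb.
    pose proof (Rmax_l M x); pose proof (Rmax_r M x).
    rewrite (is_RInt_unique_R _ _ _ _ (Ew a b ltac:(lra) ltac:(lra))).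
    specialize (HMq a b ltac:(lra) ltac:(lra)).
    rewrite <- (RInt_Chasles_R q a (-x) b), <- (RInt_Chasles_R q (-x) x b) in HMq by auto.
    replace (RInt q a (- x) + RInt q x b - (1 - RInt q (- x) x))
      with (RInt q a (- x) + (RInt q (- x) x + RInt q x b) - 1) by ring; exact HMq.
Qed.

(** Sum over the shells [n <= |z| <= n + 1]: the mass is at most [a * exp (- b n)], the weight at
    most [exp (b / 2 * (n + 1))], and the products form a geometric series of ratio
    [r = exp (- b / 2)]. The constant depends on [a] and [b] alone, hence is uniform in theta under
    GTIP. *)
Lemma exp_moment_of_tail (q : R -> R) (a b : R) :
  continuity q -> (forall z, 0 <= q z) -> improper_int q 1 -> 0 < a -> 0 < b ->
  (forall x, 0 <= x ->
     Integral (fun u => if Rle_dec (Rabs u) x then 0 else q u) <= a * exp (- (b * x))) ->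
  exists I, improper_int (fun z => exp (b / 2 * Rabs z) * q z) I /\
    I <= a * exp (b / 2) / (1 - exp (- (b / 2))).
Proof.
  intros Cq Hq H1 Ha Hb Ht.
  set (c := b / 2); set (r := exp (- c)); set (f := fun z => exp (c * Rabs z) * q z).
  assert (Hc : 0 < c) by (unfold c; lra).
  assert (Hr : 0 < r < 1).
  { split; [apply exp_pos|]; unfold r; rewrite <- exp_0; apply exp_increasing; lra. }
  assert (Cf : continuity f) by (unfold f; cont_tac).
  assert (Ef : forall u v, ex_RInt f u v) by (intros; apply cont_ex_RInt, Cf).
  assert (Eq : forall u v, ex_RInt q u v) by (intros; apply cont_ex_RInt, Cq).
  assert (Hf : forall z, 0 <= f z).
  { intros z; apply Rmult_le_pos; [left; apply exp_pos|apply Hq]. }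
  assert (HN : forall n, RInt f (- INR n) (INR n) <= a * exp c * ((1 - r ^ n) / (1 - r))).
  { induction n as [|n IH].
    - simpl; rewrite Ropp_0; right.
      transitivity (0 : R); [exact (RInt_point 0 f)|field; lra].
    - pose proof (pos_INR n) as Pn.
      set (x := INR n) in *; rewrite S_INR; fold x.
      assert (Hsh : forall u v, u <= v -> (forall z, u <= z <= v -> Rabs z <= x + 1) ->
                RInt f u v <= exp (c * (x + 1)) * RInt q u v).
      { intros u v Huv Hz.
        assert (E : RInt (fun z => exp (c * (x + 1)) * q z) u v =
                    exp (c * (x + 1)) * RInt q u v)
          by exact (RInt_scal q u v (exp (c * (x + 1))) (Eq u v)).
        rewrite <- E; apply RInt_le_cont; [exact Huv|exact Cf|cont_tac|].
        intros z Hz'; apply Rmult_le_compat_r; [apply Hq|].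
        specialize (Hz z Hz').
        apply exp_le_compat, Rmult_le_compat_l; lra. }
      pose proof (Hsh (- (x + 1)) (- x) ltac:(lra) ltac:(intros; rabs)) as L1.
      pose proof (Hsh x (x + 1) ltac:(lra) ltac:(intros; rabs)) as L2.
      rewrite <- (RInt_Chasles_R f (- (x + 1)) (- x) (x + 1)),
        <- (RInt_Chasles_R f (- x) x (x + 1)) by auto.
      specialize (Ht x Pn).
      rewrite (Integral_eq _ _ (improper_int_tail q x Cq H1 Pn)) in Ht.
      pose proof (RInt_le_improper q 1 (- (x + 1)) (x + 1) Hq H1 ltac:(lra)) as Hq1.
      rewrite <- (RInt_Chasles_R q (- (x + 1)) (- x) (x + 1)),
        <- (RInt_Chasles_R q (- x) x (x + 1)) in Hq1 by auto.
      assert (Hs : exp (c * (x + 1)) * (RInt q (- (x + 1)) (- x) + RInt q x (x + 1))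
                   <= exp (c * (x + 1)) * (a * exp (- (b * x)))).
      { apply Rmult_le_compat_l; [left; apply exp_pos|lra]. }
      assert (Ee : exp (c * (x + 1)) * (a * exp (- (b * x))) = a * exp c * r ^ n).
      { assert (Er : r ^ n = exp (- (c * x))).
        { unfold x; clear; unfold r; induction n as [|n IH].
          - simpl; rewrite Rmult_0_r, Ropp_0, exp_0; reflexivity.
          - rewrite S_INR; simpl; rewrite IH, <- exp_plus; f_equal; ring. }
        rewrite Er.
        replace (exp (c * (x + 1)) * (a * exp (- (b * x))))
          with (a * (exp (c * (x + 1)) * exp (- (b * x)))) by ring.
        rewrite Rmult_assoc, <- !exp_plus; do 2 f_equal; unfold c; field. }
      rewrite Ee in Hs.
      replace (a * exp c * ((1 - r ^ S n) / (1 - r)))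
        with (a * exp c * r ^ n + a * exp c * ((1 - r ^ n) / (1 - r)))
        by (simpl; field; lra).
      lra. }
  apply improper_int_bounded; [exact Hf|exact Ef|].
  intros M HM; destruct (INR_unbounded M) as [n Hn].
  apply Rle_trans with (RInt f (- INR n) (INR n)).
  - apply RInt_mono_interval; auto; lra.
  - eapply Rle_trans; [apply HN|].
    assert (0 < r ^ n) by (apply pow_lt; lra).
    pose proof (exp_pos c).
    unfold Rdiv; rewrite (Rmult_assoc _ (exp c)), (Rmult_assoc a (exp c)).
    apply Rmult_le_compat_l; [lra|]; apply Rmult_le_compat_l; [lra|].
    assert (0 < / (1 - r)) by (apply Rinv_0_lt_compat; lra).
    fold r; nra.
Qed.

(** * The law of the increment [u - t] and the drift of [cosh (lam t)] *)

Lemma P1_as_P0_shift (f1 f2 : R -> R) (y z t : R) :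
  P1 f1 f2 y z t = P0 f1 f2 y (z + t) t.
Proof. unfold P1, P0; do 2 f_equal; ring. Qed.

Lemma P1_as_P0_reflect (f1 f2 : R -> R) (y u t : R) :
  P1 f1 f2 y u t = P0 f2 f1 y (y - u) t.
Proof. unfold P1, P0; rewrite Rmult_comm; do 2 f_equal; ring. Qed.

Lemma P1_mass (f1 f2 : R -> R) (y t : R) :
  good_density f1 -> good_density f2 ->
  improper_int (fun z => P1 f1 f2 y z t) (marg f1 f2 y t).
Proof.
  intros H1 H2; destruct (marg_spec f1 f2 y H1 H2) as [HM _].
  refine (improper_int_ext _ _ _ _ (improper_int_shift _ t _ (HM t))).
  intros z; symmetry; apply P1_as_P0_shift.
Qed.

(** In the chain of [P0 f1 f2 y] the non-centred coordinate [z = u - t] is the increment of the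
    first half step, so [condU (P1 f1 f2 y) t] is the increment law whose mean and exponential
    moments drive the drift estimate. *)
Lemma condU_P1 (f1 f2 : R -> R) (y t z : R) :
  good_density f1 -> good_density f2 ->
  condU (P1 f1 f2 y) t z = / marg f1 f2 y t * P1 f1 f2 y z t.
Proof.
  intros H1 H2; unfold condU; rewrite (Integral_eq _ _ (P1_mass f1 f2 y t H1 H2)).
  apply Rmult_comm.
Qed.

Lemma condU_P1_density (f1 f2 : R -> R) (y t : R) :
  good_density f1 -> good_density f2 ->
  continuity (condU (P1 f1 f2 y) t) /\ (forall z, 0 <= condU (P1 f1 f2 y) t z) /\
  improper_int (condU (P1 f1 f2 y) t) 1.
Proof.
  intros H1 H2; destruct (marg_spec f1 f2 y H1 H2) as [_ [_ [PM _]]].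
  destruct (good_density_bounds f1 H1) as [C1 [[B1 [PB1 HB1]] [S1 I1]]].
  destruct (good_density_bounds f2 H2) as [C2 [[B2 [PB2 HB2]] [S2 I2]]].
  specialize (PM t); assert (0 < / marg f1 f2 y t) by (apply Rinv_0_lt_compat, PM).
  replace (condU (P1 f1 f2 y) t) with (fun z => / marg f1 f2 y t * P1 f1 f2 y z t)
    by (apply functional_extensionality; intros z; symmetry; apply condU_P1; assumption).
  split; [unfold P1; cont_tac|]; split.
  - intros z; apply Rmult_le_pos; [lra|].
    unfold P1; apply Rmult_le_pos; left; [apply HB1|apply HB2].
  - pose proof (improper_int_scal (/ marg f1 f2 y t) _ _ (P1_mass f1 f2 y t H1 H2)) as H3.
    rewrite Rinv_l in H3 by lra; exact H3.
Qed.

Lemma cosh_expand (lam s t : R) :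
  cosh (lam * (s + t)) =
  / 2 * (exp (lam * t) * exp (lam * s) + exp (- lam * t) * exp (- lam * s)).
Proof.
  unfold cosh; replace (lam * (s + t)) with (lam * t + lam * s) by ring.
  replace (- (lam * t + lam * s)) with (- lam * t + - lam * s) by ring.
  rewrite !exp_plus; field.
Qed.

Lemma mgf_exp_abs (f : R -> R) :
  good_density f -> mgf_finite_near0 f ->
  exists c I, 0 < c /\ improper_int (fun z => exp (c * Rabs z) * f z) I.
Proof.
  intros Hf [delta [Hd Hm]].
  destruct (good_density_bounds f Hf) as [Cf [[B [PB HB]] [Sf If]]].
  destruct (Hm (delta / 2)) as [I HI]; [rewrite Rabs_pos_eq; lra|].
  pose proof (improper_int_opp _ _ HI) as HI'; simpl in HI'.
  assert (Hdom : forall z, Rabs (exp (delta / 2 * Rabs z) * f z) <=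
            exp (delta / 2 * z) * f z + exp (delta / 2 * - z) * f (- z)).
  { intros z; pose proof (proj1 (HB z)); pose proof (exp_pos (delta / 2 * Rabs z)).
    rewrite Rabs_pos_eq, Sf, <- Rmult_plus_distr_r by (apply Rmult_le_pos; lra).
    apply Rmult_le_compat_r; [lra|].
    pose proof (exp_pos (delta / 2 * z)); pose proof (exp_pos (delta / 2 * - z)).
    destruct (Rcase_abs z) as [Hz|Hz]; [rewrite Rabs_left|rewrite Rabs_right]; lra. }
  destruct (improper_int_dominated (fun z => exp (delta / 2 * Rabs z) * f z) _ _
    ltac:(cont_tac) Hdom (improper_int_plus _ _ _ _ HI HI')) as [J [HJ _]].
  exists (delta / 2), J; split; [lra|exact HJ].
Qed.

(** [phi] is the moment generating function of [f] at [lam]. Evenness gives it the same value at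
    [- lam], which makes [cosh] an eigenfunction of the convolution, and kills the first moment,
    which leaves no linear term in [lam]. *)
Lemma even_density_mgf (f : R -> R) (c I lam : R) :
  good_density f -> 0 < c -> improper_int (fun z => exp (c * Rabs z) * f z) I ->
  Rabs lam <= c / 2 ->
  exists phi, 0 <= phi <= 1 + lam * lam * (16 / (c * c) * I) /\
    forall u, improper_int (fun s => f (u - s) * cosh (lam * s)) (phi * cosh (lam * u)).
Proof.
  intros Hf Hc HI Hlam.
  destruct (good_density_bounds f Hf) as [Cf [[B [PB HB]] [Sf If]]].
  assert (Pf : forall z, 0 <= f z) by (intros z; left; apply HB).
  destruct (first_moment_exists f c I Cf Pf Hc HI) as [e He].
  assert (He0 : e = 0).
  { assert (He' : improper_int (fun z => z * f z) (-1 * e)).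
    { refine (improper_int_ext _ _ _ _ (improper_int_scal (-1) _ _ (improper_int_opp _ _ He))).
      intros z; simpl; rewrite Sf; ring. }
    pose proof (improper_int_unique _ _ _ He He'); lra. }
  destruct (exp_moment_expansion f c I e lam Cf Pf If Hc HI He Hlam) as [phi [Hphi [Hp Hle]]].
  exists phi; split; [rewrite He0 in Hle; lra|].
  intros u.
  assert (Hphi' : improper_int (fun z => exp (- lam * z) * f z) phi).
  { refine (improper_int_ext _ _ _ _ (improper_int_opp _ _ Hphi)).
    intros z; simpl; rewrite Sf; do 2 f_equal; ring. }
  apply (improper_int_reflect _ u).
  replace (phi * cosh (lam * u)) with
    (/ 2 * (exp (lam * u) * phi + exp (- lam * u) * phi))
    by (unfold cosh; replace (- lam * u) with (- (lam * u)) by ring; field).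
  refine (improper_int_ext _ _ _ _ (improper_int_scal (/ 2) _ _ (improper_int_plus _ _ _ _
    (improper_int_scal (exp (lam * u)) _ _ Hphi')
    (improper_int_scal (exp (- lam * u)) _ _ Hphi)))).
  intros z; simpl.
  replace (u - (u - z)) with z by ring; replace (u - z) with (- z + u) by ring.
  rewrite cosh_expand; replace (lam * - z) with (- lam * z) by ring.
  replace (- lam * - z) with (lam * z) by ring; ring.
Qed.

(* [cosh (lam t)] turns the update of Theta given U into multiplication by a
   constant [1 + O(lam^2)], while the drift [d] of U given Theta gains a factor
   [1 - lam d + O(lam^2)]. *)
Lemma gibbs_cosh_drift (f1 f2 : R -> R) (y c C d k : R) :
  good_density f1 -> good_density f2 -> mgf_finite_near0 f2 -> 0 < c ->
  (forall t, exists I,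
     improper_int (fun z => exp (c * Rabs z) * condU (P1 f1 f2 y) t z) I /\ I <= C) ->
  0 < d -> 0 < k ->
  (forall t e, Rabs t > k -> improper_int (fun z => z * condU (P1 f1 f2 y) t z) e ->
     sgn t * e <= - d) ->
  exists V PV gam kap, drift (kern (P0 f1 f2 y)) V PV gam kap.
Proof.
  intros H1 H2 Hmgf Hc HC Hd Hk Hdr.
  destruct (mgf_exp_abs f2 H2 Hmgf) as [c2 [I2 [Hc2 HI2]]].
  destruct (marg_spec f1 f2 y H1 H2) as [HM [CM [PM _]]].
  destruct (good_density_bounds f1 H1) as [C1 [[B1 [PB1 HB1]] [S1 II1]]].
  destruct (good_density_bounds f2 H2) as [C2 [[B2 [PB2 HB2]] [S2 II2]]].
  assert (HI2p : 0 <= I2).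
  { refine (improper_int_nonneg _ _ _ HI2); intros z.
    apply Rmult_le_pos; left; [apply exp_pos|apply HB2]. }
  set (rho := condU (P1 f1 f2 y)) in *.
  assert (Hrho : forall t, continuity (rho t) /\ (forall z, 0 <= rho t z) /\
                   improper_int (rho t) 1).
  { intros t; apply condU_P1_density; assumption. }
  assert (HC0 : 0 <= C).
  { destruct (HC 0) as [I [HI HIC]]; apply Rle_trans with I; [|exact HIC].
    refine (improper_int_nonneg _ _ _ HI); intros z.
    apply Rmult_le_pos; [left; apply exp_pos|apply Hrho]. }
  (* Coefficients of [lam^2] in the two expansions; the summand 1 makes them positive, so that they
     can be divided by. *)
  set (D1 := 16 / (c * c) * C + 1); set (D2 := 16 / (c2 * c2) * I2 + 1).
  assert (HD1 : 0 < D1).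
  { unfold D1; assert (0 < 16 / (c * c)) by (apply Rdiv_lt_0_compat; nra); nra. }
  assert (HD2 : 0 < D2).
  { unfold D2; assert (0 < 16 / (c2 * c2)) by (apply Rdiv_lt_0_compat; nra); nra. }
  (* The first bounds put [lam] in the range of both expansions; [lam * d <= 1] keeps
     [1 - 3 / 4 * x] nonnegative for [x = lam * d]; the last two make each quadratic remainder at
     most a quarter of the gain [x]. *)
  assert (Hlam : exists lam, 0 < lam /\ lam <= c / 2 /\ lam <= c2 / 2 /\ lam * d <= 1 /\
            lam * D1 <= d / 4 /\ lam * D2 <= d / 4).
  { assert (Hinv : 0 < / d) by (apply Rinv_0_lt_compat, Hd).
    assert (P1' : 0 < d / (4 * D1)) by (apply Rdiv_lt_0_compat; lra).
    assert (P2' : 0 < d / (4 * D2)) by (apply Rdiv_lt_0_compat; lra).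
    set (l3 := Rmin (d / (4 * D1)) (d / (4 * D2))); set (l2 := Rmin (/ d) l3).
    set (l1 := Rmin (c2 / 2) l2); set (l0 := Rmin (c / 2) l1).
    pose proof (Rmin_l (c / 2) l1 : l0 <= _); pose proof (Rmin_r (c / 2) l1 : l0 <= _).
    pose proof (Rmin_l (c2 / 2) l2 : l1 <= _); pose proof (Rmin_r (c2 / 2) l2 : l1 <= _).
    pose proof (Rmin_l (/ d) l3 : l2 <= _); pose proof (Rmin_r (/ d) l3 : l2 <= _).
    pose proof (Rmin_l _ _ : l3 <= d / (4 * D1)); pose proof (Rmin_r _ _ : l3 <= d / (4 * D2)).
    exists l0; repeat split; try lra.
    - repeat apply Rmin_pos; lra.
    - apply Rle_trans with (/ d * d); [apply Rmult_le_compat_r; lra|right; field; lra].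
    - apply Rle_trans with (d / (4 * D1) * D1); [apply Rmult_le_compat_r; lra|right; field; lra].
    - apply Rle_trans with (d / (4 * D2) * D2); [apply Rmult_le_compat_r; lra|right; field; lra]. }
  destruct Hlam as [lam [Pl [Hlc [Hlc2 [Hld [HlD1 HlD2]]]]]].
  destruct (even_density_mgf f2 c2 I2 lam H2 Hc2 HI2) as [phi [Hphi Hconv]];
    [rewrite Rabs_pos_eq; lra|].
  set (x := lam * d) in *.
  assert (Hx : 0 < x) by (apply Rmult_lt_0_compat; assumption).
  assert (HlD1x : lam * lam * D1 <= x / 4).
  { apply (Rmult_le_compat_l lam) in HlD1; unfold x; lra. }
  assert (HlD2x : lam * lam * D2 <= x / 4).
  { apply (Rmult_le_compat_l lam) in HlD2; unfold x; lra. }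
  assert (Hphix : phi <= 1 + x / 4) by (unfold D2 in HlD2x; nra).
  set (V := fun t => cosh (lam * t)).
  assert (CV : continuity V) by (unfold V; cont_tac).
  assert (HV1 : forall t, 1 <= V t) by (intros t; apply cosh_ge_1).
  assert (HVe : forall t, exp (lam * t) <= 2 * V t /\ exp (- lam * t) <= 2 * V t).
  { intros t; unfold V, cosh; replace (- lam * t) with (- (lam * t)) by ring.
    pose proof (exp_pos (lam * t)); pose proof (exp_pos (- (lam * t))); lra. }
  (* [s] is [lam] or [- lam]. When it has the sign of a large [t], the mean drift gives
     [s * e <= - x], whence [1 - x + x / 4]; in the opposite direction only the uniform bound [C] is
     available. *)
  assert (HL : forall t s, Rabs s = lam -> exists L,
            improper_int (fun z => exp (s * z) * rho t z) L /\ 0 <= L <= C /\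
            (k < Rabs t -> s * t = lam * Rabs t -> L <= 1 - 3 / 4 * x)).
  { intros t s Hs; destruct (HC t) as [I [HI HIC]]; destruct (Hrho t) as [Cr [Pr Ir]].
    destruct (first_moment_exists (rho t) c I Cr Pr Hc HI) as [e He].
    destruct (exp_moment_expansion (rho t) c I e s Cr Pr Ir Hc HI He) as [L [HL [HLp HLe]]];
      [lra|].
    exists L; split; [exact HL|]; split; [lra|]; intros Ht Hst.
    specialize (Hdr t e Ht He).
    assert (Ess : s * s = lam * lam).
    { rewrite <- Hs, <- Rabs_mult, Rabs_pos_eq; [reflexivity|nra]. }
    assert (Es : s = lam * sgn t).
    { unfold sgn; destruct Rlt_dec as [Hp|Hn]; [|destruct Rlt_dec as [Hp'|Hn']].
      - rewrite Rabs_pos_eq in Hst by lra; nra.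
      - rewrite Rabs_left in Hst by lra; nra.
      - replace t with 0 in Ht by lra; rewrite Rabs_R0 in Ht; lra. }
    assert (Hse : s * e <= - x).
    { rewrite Es, Rmult_assoc; unfold x.
      apply (Rmult_le_compat_l lam) in Hdr; lra. }
    assert (H16 : 16 / (c * c) * I <= D1).
    { unfold D1; assert (0 < 16 / (c * c)) by (apply Rdiv_lt_0_compat; nra); nra. }
    rewrite Ess in HLe.
    assert (lam * lam * (16 / (c * c) * I) <= lam * lam * D1)
      by (apply Rmult_le_compat_l; nra).
    lra. }
  (* [T t / marg f1 f2 y t] is the conditional mean of [cosh (lam u)] given [t], in the increment
     coordinate. *)
  set (T := fun t => Integral (fun z => P1 f1 f2 y z t * cosh (lam * (z + t)))).
  assert (HT : forall t Lp Lm,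
            improper_int (fun z => exp (lam * z) * rho t z) Lp ->
            improper_int (fun z => exp (- lam * z) * rho t z) Lm ->
            improper_int (fun z => P1 f1 f2 y z t * cosh (lam * (z + t)))
              (marg f1 f2 y t * (/ 2 * (exp (lam * t) * Lp + exp (- lam * t) * Lm)))).
  { intros t Lp Lm HLp HLm; specialize (PM t).
    refine (improper_int_ext _ _ _ _ (improper_int_scal (marg f1 f2 y t) _ _
      (improper_int_scal (/ 2) _ _ (improper_int_plus _ _ _ _
        (improper_int_scal (exp (lam * t)) _ _ HLp)
        (improper_int_scal (exp (- lam * t)) _ _ HLm))))).
    intros z; simpl; rewrite cosh_expand; unfold rho.
    rewrite condU_P1 by assumption; field; lra. }
  assert (HTi : forall t, improper_int (fun z => P1 f1 f2 y z t * cosh (lam * (z + t))) (T t)).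
  { intros t; destruct (HL t lam) as [Lp [HLp _]]; [apply Rabs_pos_eq; lra|].
    destruct (HL t (- lam)) as [Lm [HLm _]]; [rewrite Rabs_Ropp; apply Rabs_pos_eq; lra|].
    specialize (HT t Lp Lm HLp HLm); unfold T; rewrite (Integral_eq _ _ HT); exact HT. }
  assert (CT : continuity T).
  { apply (improper_int_param_cont (fun t z => P1 f1 f2 y z t * cosh (lam * (z + t))));
      [unfold P1; cont_tac|exact HTi|].
    (* For [|t| <= K] the shift by [t] costs at most a factor [2 * exp (lam * K)]. Writing
       [f2 (0 - z)] makes the bound an instance of the eigenfunction identity at [u = 0], which
       gives its integral. *)
    intros K; exists (fun z => B1 * (2 * exp (lam * K)) * (f2 (0 - z) * cosh (lam * z))); eexists.
    split; [apply improper_int_scal, Hconv|]; intros t z Ht.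
    pose proof (cosh_ge_1 (lam * (z + t))) as G1; pose proof (cosh_ge_1 (lam * z)) as G2.
    pose proof (exp_pos (lam * K)) as G3.
    assert (Gc : cosh (lam * (z + t)) <= 2 * exp (lam * K) * cosh (lam * z)).
    { eapply Rle_trans; [apply cosh_le_exp|].
      pose proof (exp_le_cosh (lam * z)).
      apply Rle_trans with (exp (lam * K) * exp (Rabs (lam * z))); [|nra].
      rewrite <- exp_plus; apply exp_le_compat.
      rewrite !Rabs_mult, (Rabs_pos_eq lam) by lra.
      pose proof (Rabs_triang z t); nra. }
    unfold P1; replace (0 - z) with (- z) by ring; rewrite S2.
    specialize (HB1 (y - (z + t))); specialize (HB2 z).
    rewrite Rabs_pos_eq by (apply Rmult_le_pos; [apply Rmult_le_pos|]; lra).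
    replace (B1 * (2 * exp (lam * K)) * (f2 z * cosh (lam * z)))
      with (B1 * f2 z * (2 * exp (lam * K) * cosh (lam * z))) by ring.
    apply Rmult_le_compat; [apply Rmult_le_pos; lra|lra| |exact Gc].
    apply Rmult_le_compat_r; lra. }
  (* The rate is below 1 since the gain [3 / 4 * x] of the [u] update outweighs the loss [x / 4] in
     [phi]. In the constant, the factor 2 bounds [1 + x / 4] and the final 1 ensures positivity. *)
  exists V, (fun t => phi * T t / marg f1 f2 y t), ((1 - 3 / 4 * x) * (1 + x / 4)),
    (2 * (C * (exp (lam * k) + 1)) + 1).
  split; [exact CV|]; split; [exact HV1|]; split; [|split; [|split; [|split; [|split]]]].
  - intros L; exists (2 * Rabs L / lam); intros t Ht.
    assert (HtL : 2 * Rabs L <= lam * Rabs t).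
    { apply Rle_trans with (lam * (2 * Rabs L / lam)); [right; field; lra|].
      apply Rmult_le_compat_l; lra. }
    pose proof (exp_le_cosh (lam * t)) as He; pose proof (exp_ineq1_le (Rabs (lam * t))).
    rewrite Rabs_mult, (Rabs_pos_eq lam) in * by lra.
    unfold V; pose proof (Rle_abs L); lra.
  - assert (Cphi : continuity (fun t => phi * T t)) by cont_tac.
    cont_tac; intros t; apply Rgt_not_eq, PM.
  - intros t; specialize (PM t).
    assert (HTu : improper_int (fun u => P0 f1 f2 y u t * (phi * cosh (lam * u))) (phi * T t)).
    { refine (improper_int_ext _ _ _ _ (improper_int_scal phi _ _
        (improper_int_shift _ (- t) _ (HTi t)))).
      intros u; simpl; rewrite P1_as_P0_shift.
      replace (u + - t + t) with u by ring; ring. }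
    pose proof (joint_weight f1 f2 y V (fun u => phi * cosh (lam * u)) t (phi * T t) H1 H2 CV)
      as HJ.
    assert (Cphi : continuity (fun u => phi * cosh (lam * u))) by cont_tac.
    specialize (HJ ltac:(intros s; specialize (HV1 s); lra) Cphi Hconv HTu).
    unfold Rdiv; rewrite Rmult_comm.
    refine (improper_int_ext _ _ _ _ (improper_int_scal (/ marg f1 f2 y t) _ _ HJ)).
    intros s; simpl; rewrite kern_P0 by assumption; unfold Rdiv; ring.
  - split; [apply Rmult_le_pos; lra|nra].
  - pose proof (exp_pos (lam * k)).
    assert (0 <= C * (exp (lam * k) + 1)) by (apply Rmult_le_pos; lra); lra.
  - intros t; specialize (PM t).
    destruct (HL t lam) as [Lp [HLp [HLpC HLpx]]]; [apply Rabs_pos_eq; lra|].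
    destruct (HL t (- lam)) as [Lm [HLm [HLmC HLmx]]];
      [rewrite Rabs_Ropp; apply Rabs_pos_eq; lra|].
    rewrite (improper_int_unique _ _ _ (HTi t) (HT t Lp Lm HLp HLm)).
    set (Ep := exp (lam * t)) in *; set (Em := exp (- lam * t)) in *.
    assert (PEp : 0 < Ep) by apply exp_pos; assert (PEm : 0 < Em) by apply exp_pos.
    replace (phi * (marg f1 f2 y t * (/ 2 * (Ep * Lp + Em * Lm))) / marg f1 f2 y t)
      with (phi * (/ 2 * (Ep * Lp + Em * Lm))) by (field; lra).
    destruct (HVe t) as [HVp HVm]; fold Ep in HVp; fold Em in HVm.
    specialize (HV1 t).
    assert (Hx1 : 0 <= 1 - 3 / 4 * x) by lra.
    assert (Pk : 0 < exp (lam * k)) by apply exp_pos.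
    assert (Hfin : forall A, 0 <= A ->
              A <= (1 - 3 / 4 * x) * V t + C * (exp (lam * k) + 1) ->
              phi * A <= (1 - 3 / 4 * x) * (1 + x / 4) * V t +
                         (2 * (C * (exp (lam * k) + 1)) + 1)).
    { intros A HA0 HA.
      assert (0 <= C * (exp (lam * k) + 1)) by (apply Rmult_le_pos; lra).
      apply Rle_trans with
        ((1 + x / 4) * ((1 - 3 / 4 * x) * V t + C * (exp (lam * k) + 1)));
        [apply Rmult_le_compat; lra|nra]. }
    assert (PEL : 0 <= Ep * Lp) by (apply Rmult_le_pos; lra).
    assert (MEL : 0 <= Em * Lm) by (apply Rmult_le_pos; lra).
    apply Hfin; [lra|].
    (* For [|t| <= k] both exponentials are at most [exp (lam * k)]. Otherwise the one with positive
       exponent is at most [2 * V t] and meets the contracted moment, while the other is at most 1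
       and contributes at most [C]. *)
    destruct (Rle_lt_dec (Rabs t) k) as [Ht|Ht].
    + assert (HEp : Ep <= exp (lam * k)).
      { apply exp_le_compat, Rmult_le_compat_l; [lra|]; pose proof (Rle_abs t); lra. }
      assert (HEm : Em <= exp (lam * k)).
      { unfold Em; replace (- lam * t) with (lam * - t) by ring.
        apply exp_le_compat, Rmult_le_compat_l; [lra|]; pose proof (Rle_abs (- t)).
        rewrite Rabs_Ropp in *; lra. }
      assert (Ep * Lp <= exp (lam * k) * C) by (apply Rmult_le_compat; lra).
      assert (Em * Lm <= exp (lam * k) * C) by (apply Rmult_le_compat; lra).
      assert (0 <= (1 - 3 / 4 * x) * V t) by (apply Rmult_le_pos; lra).
      lra.
    + assert (0 <= C * exp (lam * k)) by (apply Rmult_le_pos; lra).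
      destruct (Rle_lt_dec 0 t) as [Ht0|Ht0].
      * rewrite (Rabs_pos_eq t) in * by lra.
        assert (Ep * Lp <= 2 * V t * (1 - 3 / 4 * x))
          by (apply Rmult_le_compat; [lra|lra|lra|apply HLpx; lra]).
        assert (Em <= 1).
        { unfold Em; rewrite <- exp_0; apply exp_le_compat; nra. }
        assert (Em * Lm <= 1 * C) by (apply Rmult_le_compat; lra).
        lra.
      * rewrite (Rabs_left t) in * by lra.
        assert (Em * Lm <= 2 * V t * (1 - 3 / 4 * x))
          by (apply Rmult_le_compat; [lra|lra|lra|apply HLmx; lra]).
        assert (Ep <= 1).
        { unfold Ep; rewrite <- exp_0; apply exp_le_compat; nra. }
        assert (Ep * Lp <= 1 * C) by (apply Rmult_le_compat; lra).
        lra.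
Qed.

Lemma gibbs_geom_ergodic (f1 f2 : R -> R) (y c C d k : R) :
  good_density f1 -> good_density f2 -> mgf_finite_near0 f2 -> 0 < c ->
  (forall t, exists I,
     improper_int (fun z => exp (c * Rabs z) * condU (P1 f1 f2 y) t z) I /\ I <= C) ->
  0 < d -> 0 < k ->
  (forall t e, Rabs t > k -> improper_int (fun z => z * condU (P1 f1 f2 y) t z) e ->
     sgn t * e <= - d) ->
  geom_ergodic (P0 f1 f2 y).
Proof.
  intros H1 H2 Hmgf Hc HC Hd Hk Hdr.
  destruct (gibbs_cosh_drift f1 f2 y c C d k H1 H2 Hmgf Hc HC Hd Hk Hdr)
    as [V [PV [gam [kap HD]]]].
  destruct (marg_spec f1 f2 y H1 H2) as [_ [CM [PM _]]].
  assert (E : marg f1 f2 y = post (P0 f1 f2 y)).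
  { apply functional_extensionality; intros t; symmetry; apply post_P0; assumption. }
  apply (drift_geom_ergodic _ V PV gam kap).
  - apply kern_P0_markov; assumption.
  - exact HD.
  - rewrite <- E; exact CM.
  - rewrite <- E; intros t; left; apply PM.
  - rewrite <- E; apply marg_mass; assumption.
  - intros t'; apply post_P0_stationary; assumption.
Qed.

(** * Transfer between the parametrisations and conclusion *)

Lemma geom_ergodic_ext (g g' : R -> R -> R) :
  (forall t t', kern g t t' = kern g' t t') -> (forall t, post g t = post g' t) ->
  geom_ergodic g -> geom_ergodic g'.
Proof.
  intros HK HP [r [M [Hr H]]]; exists r, M; split; [exact Hr|].
  intros th0 n; replace (tv_dist g' th0 n) with (tv_dist g th0 n); [apply H|].
  destruct n as [|m]; [reflexivity|]; simpl; do 2 f_equal.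
  assert (HS : forall t, step_dens g th0 m t = step_dens g' th0 m t).
  { induction m as [|m IH]; intros t; simpl; [apply HK|].
    f_equal; apply functional_extensionality; intros s; rewrite IH, HK; reflexivity. }
  apply functional_extensionality; intros t; rewrite HS, HP; reflexivity.
Qed.

Lemma condU_P1_reflect (f1 f2 : R -> R) (y t u : R) :
  condU (P1 f1 f2 y) t u = condU (P0 f2 f1 y) t (y - u).
Proof.
  unfold condU; rewrite P1_as_P0_reflect; f_equal.
  rewrite <- (Integral_reflect (fun v => P0 f2 f1 y v t) y).
  f_equal; apply functional_extensionality; intros v; apply P1_as_P0_reflect.
Qed.

(** The reflection changes only the auxiliary variable [u], which both [kern] and [post] integrate
    out; so the Theta chains of the two samplers coincide. *)
Lemma geom_ergodic_P1 (f1 f2 : R -> R) (y : R) :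
  geom_ergodic (P0 f2 f1 y) -> geom_ergodic (P1 f1 f2 y).
Proof.
  apply geom_ergodic_ext.
  - intros t t'; unfold kern.
    rewrite <- (Integral_reflect
      (fun u => condU (P0 f2 f1 y) t u * condT (P0 f2 f1 y) u t') y).
    f_equal; apply functional_extensionality; intros u.
    rewrite condU_P1_reflect; unfold condT; rewrite P1_as_P0_reflect; do 3 f_equal.
    apply functional_extensionality; intros s; symmetry; apply P1_as_P0_reflect.
  - assert (E : forall t, Integral (fun u => P0 f2 f1 y u t) =
                          Integral (fun u => P1 f1 f2 y u t)).
    { intros t; rewrite <- (Integral_reflect _ y); f_equal.
      apply functional_extensionality; intros u; symmetry; apply P1_as_P0_reflect. }
    intros t; unfold post; rewrite E; do 2 f_equal.
    apply functional_extensionality; exact E.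
Qed.

Theorem mainTheorem3 (f1 f2 : R -> R) (y : R) :
  good_density f1 -> good_density f2 ->
  (DUR f1 f2 y -> GTIP (P1 f1 f2 y) -> mgf_finite_near0 f2 ->
     geom_ergodic (P0 f1 f2 y)) /\
  (PUR f1 f2 y -> GTIP (P0 f1 f2 y) -> mgf_finite_near0 f1 ->
     geom_ergodic (P1 f1 f2 y)).
Proof.
  intros H1 H2; split.
  - intros [d [k [Hd [Hk Hdur]]]] [a [b [Ha [Hb Ht]]]] Hm.
    apply (gibbs_geom_ergodic f1 f2 y (b / 2)
      (a * exp (b / 2) / (1 - exp (- (b / 2)))) d k); auto; [lra| |].
    + intros t; destruct (condU_P1_density f1 f2 y t H1 H2) as [Cr [Pr Ir]].
      apply exp_moment_of_tail; auto; intros x Hx; apply Ht, Hx.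
    + intros t e Htk He; specialize (Hdur t Htk).
      destruct (condU_P1_density f1 f2 y t H1 H2) as [Cr [Pr Ir]].
      (* [X] is Theta plus the increment, so DUR reads [|e + t| <= |t| - d], which bounds
         [sgn t * e] by [- d]. *)
      assert (HX : condExpX f1 f2 y t = e + t).
      { apply Integral_eq; replace (e + t) with (e + t * 1) by ring.
        refine (improper_int_ext _ _ _ _ (improper_int_shift _ (- t) _
          (improper_int_plus _ _ _ _ He (improper_int_scal t _ _ Ir)))).
        intros x; simpl.
        assert (E : condU (P1 f1 f2 y) t (x + - t) = condU (P0 f1 f2 y) t x).
        { rewrite condU_P1 by assumption; rewrite P1_as_P0_shift.
          replace (x + - t + t) with x by ring; unfold condU, marg; apply Rmult_comm. }
        rewrite E; ring. }
      rewrite HX in Hdur; apply Rabs_le_between in Hdur; unfold sgn.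
      destruct Rlt_dec as [Hp|Hn]; [rewrite Rabs_pos_eq in Hdur; lra|].
      destruct Rlt_dec as [Hp'|Hn']; [rewrite Rabs_left in Hdur; lra|].
      replace t with 0 in Htk by lra; rewrite Rabs_R0 in Htk; lra.
  - intros [d [k [Hd [Hk Hpur]]]] [a [b [Ha [Hb Ht]]]] Hm.
    apply geom_ergodic_P1.
    (* The increment of the chain with swapped densities is [y - X]: GTIP of [P0] bounds its tails
       after recentring, and PUR gives its mean up to sign. *)
    assert (Er : forall t z, condU (P0 f1 f2 y) t z = condU (P1 f2 f1 y) t (y - z)).
    { intros t z; rewrite condU_P1_reflect; f_equal; ring. }
    set (C := a * exp (b / 2) / (1 - exp (- (b / 2)))).
    (* The extra factor pays for the recentring, through [|z| <= |y| + |y - z|]. *)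
    apply (gibbs_geom_ergodic f2 f1 y (b / 2) (exp (b / 2 * Rabs y) * C) d k); auto; [lra| |].
    + intros t; destruct (condU_P1_density f2 f1 y t H2 H1) as [Cr [Pr Ir]].
      set (rho := condU (P1 f2 f1 y) t) in *.
      destruct (exp_moment_of_tail (fun z => rho (y - z)) a b) as [I [HI HIC]]; auto.
      * cont_tac.
      * apply improper_int_reflect, Ir.
      * intros x Hx; specialize (Ht t x Hx); unfold tail_prob in Ht.
        refine (Rle_trans _ _ _ (Req_le _ _ _) Ht); f_equal.
        apply functional_extensionality; intros u; rewrite Er; reflexivity.
      * assert (Hdom : forall z, Rabs (exp (b / 2 * Rabs z) * rho z) <=
                  exp (b / 2 * Rabs y) * (exp (b / 2 * Rabs (y - z)) * rho z)).
        { intros z; rewrite Rabs_pos_eq by (apply Rmult_le_pos; [left; apply exp_pos|apply Pr]).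
          rewrite <- Rmult_assoc; apply Rmult_le_compat_r; [apply Pr|].
          rewrite <- exp_plus, <- Rmult_plus_distr_l.
          apply exp_le_compat, Rmult_le_compat_l; [lra|].
          pose proof (Rabs_triang y (- (y - z))) as Htr; rewrite Rabs_Ropp in Htr.
          replace (y + - (y - z)) with z in Htr by ring; lra. }
        assert (HIr : improper_int (fun z => exp (b / 2 * Rabs (y - z)) * rho z) I).
        { refine (improper_int_ext _ _ _ _ (proj2 (improper_int_reflect _ y _) HI)).
          intros z; simpl; do 2 f_equal; ring. }
        assert (Cer : continuity (fun z => exp (b / 2 * Rabs z) * rho z)) by cont_tac.
        destruct (improper_int_dominated _ _ _ Cer Hdom
          (improper_int_scal (exp (b / 2 * Rabs y)) _ _ HIr)) as [J [HJ HJI]].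
        exists J; split; [exact HJ|]; apply Rabs_le_between in HJI.
        apply Rle_trans with (exp (b / 2 * Rabs y) * I); [lra|].
        apply Rmult_le_compat_l; [left; apply exp_pos|exact HIC].
    + intros t e Htk He; specialize (Hpur t Htk).
      assert (HX : condExpXy f1 f2 y t = -1 * e).
      { apply Integral_eq; apply (improper_int_reflect _ y).
        refine (improper_int_ext _ _ _ _ (improper_int_scal (-1) _ _ He)).
        intros z; simpl; rewrite Er; replace (y - (y - z)) with z by ring; ring. }
      rewrite HX in Hpur; lra.
Qed.
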